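(* Let $(X,d,m)$ be a locally compact, connected, separable uniform local tree with a Radon measure $m$ of full support satisfying the uniform volume control with volume growth function $\Phi(r)=r^{d_h}$, $d_h\ge1$ (see context). Let $p\ge1$. Then $$\sup\left\{\alpha\ge0:\ \mathcal B^{\alpha,p}(X,m)\text{ contains non-constant functions}\right\}=1+\frac{d_h-1}{p}.$$
   Context: Balls are $B(x,r)=\{y:d(x,y)<r\}$. A metric space $(T,d)$ is a (real) tree if (1) for all $u,v\in T$ there is a unique isometric embedding $\phi_{u,v}:[0,d(u,v)]\to T$ with $\phi_{u,v}(0)=u$, $\phi_{u,v}(d(u,v))=v$; (2) every injective continuous $\kappa:[0,1]\to T$ satisfies $\kappa([0,1])=\phi_{\kappa(0),\kappa(1)}([0,d(\kappa(0),\kappa(1))])$. A metric space $(X,d)$ is a local tree if for every $x\in X$ there is $\iota(x)>0$ such that $B(x,\iota(x))$ is a tree. Standing assumption: $(X,d)$ is a locally compact, connected, separable local tree and $m$ is a Radon measure on $X$ with full support. Uniform volume control with $\Phi(r)=r^{d_h}$: there are $r_0>0$ and constants $c,C>0$ such that $c\,r^{d_h}\le m(B(x,r))\le C\,r^{d_h}$ for all $x\in X$, $0<r<r_0$. Uniform local tree: there is $0<\underline\iota\le\mathrm{diam}(X)$ such that $B(x,\underline\iota)$ is a tree for every $x\in X$. For $p\ge1$, $\alpha\ge0$, $$E_{p,\alpha}(f,r)=\int_X\frac1{m(B(x,r))}\left(\int_{B(x,r)}\frac{|f(y)-f(x)|^p}{r^{p\alpha}}\,dm(y)\right)dm(x),$$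 and the Besov–Lipschitz space is $\mathcal B^{\alpha,p}(X,m)=\{f\in L^p(X,m):\sup_{0<r<1}E_{p,\alpha}(f,r)<+\infty\}$. Constant means $m$-a.e. constant.
   Formalization: It is additionally assumed that every ball B(x,r), r>0, has finite measure, so that the factor 1/m(B(x,r)) in the energy is defined; the volume control gives this only for r<r_0, and without it the claim can fail on non-geodesic spaces. *)

(* Defs.v *)
From HB Require Import structures.
From mathcomp Require Import all_boot all_order all_algebra.
From mathcomp Require Import all_classical all_reals all_analysis.

Set Implicit Arguments.
Unset Strict Implicit.
Unset Printing Implicit Defensive.

Import Order.TTheory GRing.Theory Num.Theory.
Import numFieldNormedType.Exports.

Local Open Scope classical_set_scope.
Local Open Scope ring_scope.

(* A metric space with a (irrelevant) distinguished point: the generated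
   sigma-algebras of the library are only defined over pointed types. *)
#[short(type="pmetricType")]
HB.structure Definition PointedMetric (K : numDomainType) :=
  {M of Pointed M & Metric K M}.

Notation borel X := (g_sigma_algebraType (@open X)).

Section trees.
Context {R : realType} {X : metricType R}.
Implicit Types (A : set X) (u v x : X).

(* [phi] restricted to [0, d(u, v)] is an isometric embedding into the
   subspace [A] joining [u] to [v]; values outside the interval are junk. *)
Definition is_segment A u v (phi : R -> X) : Prop :=
  [/\ phi 0 = u,
      phi (mdist u v) = v,
      (forall t, t \in `[0, mdist u v] -> A (phi t)) &
      {in `[0, mdist u v] &, forall s t, mdist (phi s) (phi t) = `|s - t|}].

(* The subspace [A], with the induced metric, is a real tree. *)
Definition is_tree A : Prop :=
  (forall u v, A u -> A v ->
     exists phi, is_segment A u v phi /\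
       forall psi, is_segment A u v psi -> {in `[0, mdist u v], psi =1 phi})
  /\
  (forall kappa : R -> X,
     {within `[0, 1], continuous kappa} ->
     {in `[0, 1] &, injective kappa} ->
     kappa @` `[0, 1] `<=` A ->
     forall phi, is_segment A (kappa 0) (kappa 1) phi ->
       kappa @` `[0, 1] = phi @` `[0, mdist (kappa 0) (kappa 1)]).

End trees.

Definition diam {R : realType} (X : metricType R) : \bar R :=
  ereal_sup [set (mdist x y)%:E | x in [set: X] & y in [set: X]].

Definition uniform_local_tree {R : realType} (X : metricType R) : Prop :=
  exists iota : R,
    [/\ 0 < iota, (iota%:E <= diam X)%E & forall x : X, is_tree (ball x iota)].

Definition separable (T : topologicalType) : Prop :=
  exists2 D : set T, countable D & dense D.

Section measures.
Context {R : realType} {X : pmetricType R}.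
Variable m : {measure set (borel X) -> \bar R}.
Local Open Scope ereal_scope.

Definition radon : Prop :=
  [/\ forall K : set X, compact K -> m K < +oo,
      forall B : set (borel X), measurable B ->
        m B = ereal_inf [set m U | U in [set U : set X | open U /\ B `<=` U]] &
      forall U : set X, open U ->
        m U = ereal_sup [set m K | K in [set K : set X | compact K /\ K `<=` U]]].

Definition full_support : Prop :=
  forall U : set X, open U -> U !=set0 -> 0 < m U.

Definition uniform_volume_control (Phi : R -> R) : Prop :=
  exists r0 c C : R, [/\ (0 < r0)%R, (0 < c)%R, (0 < C)%R &
    forall (x : X) (r : R), (0 < r < r0)%R ->
      (c * Phi r)%:E <= m (ball x r) <= (C * Phi r)%:E].

(* The weight 1 / m(B(x, r)) is a real number only when the ball has finite
   measure; positivity follows from [full_support]. Uniform volume control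
   says nothing about radii r >= r0, and on a non-geodesic space such as R
   with a bounded metric large balls can have infinite measure. *)
Definition finite_balls : Prop :=
  forall (x : X) (r : R), (0 < r)%R -> m (ball x r) < +oo.

Definition besov_energy (p a : R) (f : borel X -> R) (r : R) : \bar R :=
  \int[m]_x ((m (ball (x : X) r))^-1 *
    \int[m]_(y in ball (x : X) r) (`|f y - f x| `^ p / r `^ (p * a))%:E).

Definition besov_lipschitz (a p : R) : set (borel X -> R) :=
  [set f | f \in Lfun m p%:E /\
     ereal_sup [set besov_energy p a f r | r in `]0%R, 1%R[] < +oo].

Definition ae_constant (f : borel X -> R) : Prop :=
  exists c : R, {ae m, forall x, f x = c}.

End measures.

(* Main.v *)
Require Import Defs.
From mathcomp Require Import all_boot all_order all_algebra.
From mathcomp Require Import all_classical all_reals all_analysis.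
From mathcomp Require Import measurable_realfun.
From mathcomp Require Import lra ring.

Import Order.TTheory GRing.Theory Num.Theory.
Import numFieldNormedType.Exports.

Local Open Scope classical_set_scope.
Local Open Scope ring_scope.

(** Write a0 = 1 + (dh - 1) / p for the claimed supremum, so that
    p * a0 = p + dh - 1.

    No larger exponent.  Let f have bounded energies at an exponent a > a0.
    Compare values of f through medians [g x] of f on the balls of radius r.
    If two balls of radius r have centres at distance at most 2 r, each point
    of a half of the first ball sees a half of the second one across the gap
    between the two medians ([median_gap]), so the gap is paid for by the
    energy at scale 4 r.  Along a geodesic, centres 2 r apart give disjoint
    balls, and their contributions to one and the same energy add up
    ([chain_energy]).  There are about 1 / r of them, and a > a0 is exactly
    what makes the sum of the gaps tend to 0 with r ([medians_close]): on a
    tree ball all medians merge into one number.  The energy also forces f to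
    be close to its medians, so f concentrates at a constant and is a.e.
    constant on every tree ball ([ae_constant_on_ball]); connectedness glues
    these constants ([ae_constant_of_energy]).  The energy is bounded below by
    integrals of step functions, so the measurability of its inner integral
    does not come in.

    The exponent a0 is attained.  In a tree ball around o, take the finitely
    many branches that reach from radius rho to radius 2 rho, and let the
    skeleton be the finite tree formed by their parts of radius at most rho.
    The test function is rho minus the distance from o to the projection onto
    the skeleton; it vanishes from radius 2 rho on, so it extends by zero.  It
    is locally constant off the skeleton ([skeleton_near]), hence at scale r it
    varies, and by at most r, only on a set of measure of order r^(dh - 1)
    ([variation_set_small]).  Its energy is thus of order
    r^(p + dh - 1 - p * a0) = 1.  The projection is expressed through Gromov
    products, and controlled by the fact that tree balls are 0-hyperbolic
    ([tree_hyperbolic]). *)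

Set Implicit Arguments.
Unset Strict Implicit.
Unset Printing Implicit Defensive.

(** * Gromov products in tree balls *)

Section Trees.
Context {R : realType} {X : metricType R}.
Implicit Types (A : set X) (o x y z a : X) (phi psi : R -> X).

Definition gromov_product o x y : R := (mdist o x + mdist o y - mdist x y) / 2.

(** The triangle inequality and symmetry with distances read in the real field
    R rather than in its underlying numeric domain, so that linear arithmetic
    identifies equal distances. *)
Lemma mdist_triangle x y z : mdist x z <= mdist x y + mdist y z.
Proof. exact: metric_triangle. Qed.

Lemma mdist_sym x y : mdist x y = mdist y x :> R.
Proof. exact: metric_sym. Qed.

Lemma mdist_ball x y r : ball x r y = (mdist x y < r) :> Prop.
Proof. by rewrite ballEmdist. Qed.

Lemma ball_is_open x r : open (ball x r).
Proof.
rewrite openE => y; rewrite mdist_ball => xy.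
rewrite /interior -filter_from_ballE; exists (r - mdist x y) => /=.
  by rewrite subr_gt0.
move=> z; rewrite !mdist_ball => yz.
by have := mdist_triangle x y z; lra.
Qed.

Lemma mdist_lip x y z : `|mdist x z - mdist y z| <= mdist x y.
Proof.
have := mdist_triangle x y z; have := mdist_triangle y x z.
by rewrite (mdist_sym y x) ler_norml => *; apply/andP; split; lra.
Qed.

Lemma gromov_lip o a x y : `|gromov_product o x a - gromov_product o y a| <= mdist x y.
Proof.
have := mdist_lip x y a; have := mdist_lip x y o.
rewrite (mdist_sym x o) (mdist_sym y o) /gromov_product !ler_norml.
by move=> /andP[? ?] /andP[? ?]; apply/andP; split; lra.
Qed.

Lemma gromovC o x y : gromov_product o x y = gromov_product o y x :> R.
Proof. by rewrite /gromov_product (mdist_sym x y); lra. Qed.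

Lemma gromov_ge0 o x y : 0 <= gromov_product o x y.
Proof. by have := mdist_triangle x o y; rewrite (mdist_sym x o) /gromov_product; lra. Qed.

Lemma gromov_le o x y : gromov_product o x y <= mdist o x.
Proof. by have := mdist_triangle o x y; rewrite /gromov_product; lra. Qed.

Lemma segment_dist A x y phi s t : is_segment A x y phi ->
  0 <= s <= mdist x y -> 0 <= t <= mdist x y -> mdist (phi s) (phi t) = `|s - t| :> R.
Proof. by move=> [_ _ _ +] s01 t01; apply; rewrite in_itv. Qed.

Lemma segment_dist0 A x y phi t : is_segment A x y phi ->
  0 <= t <= mdist x y -> mdist x (phi t) = t :> R.
Proof.
move=> seg t01; have [phi0 _ _ _] := seg; rewrite -[in mdist x _]phi0.
rewrite (segment_dist seg) ?lexx ?mdist_ge0//.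
by rewrite sub0r normrN ger0_norm; case/andP: t01.
Qed.

Lemma segment_dist1 A x y phi t : is_segment A x y phi ->
  0 <= t <= mdist x y -> mdist (phi t) y = mdist x y - t :> R.
Proof.
move=> seg t01; have [_ phi1 _ _] := seg; rewrite -[in mdist _ y]phi1.
rewrite (segment_dist seg) ?lexx ?mdist_ge0//.
by rewrite distrC ger0_norm; case/andP: t01 => *; lra.
Qed.

Lemma segment_prefix A x y phi t : is_segment A x y phi ->
  0 <= t <= mdist x y -> is_segment A x (phi t) phi.
Proof.
move=> seg t01; have E := segment_dist0 seg t01; have [phi0 phi1 Aphi iso] := seg.
case/andP: t01 => t0 t1.
have sub s : s \in `[0, mdist x (phi t)] -> s \in `[0, mdist x y].
  by rewrite E !in_itv/= => /andP[-> /le_trans]; apply.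
split=> // [|s /sub|s s' /sub sI /sub]; [by rewrite E|exact: Aphi|exact: iso].
Qed.

(** Both geodesics, cut at the common point [phi t], join [o] to it, and
    geodesics are unique. *)
Lemma segment_agree A o x y phi psi t : is_tree A -> A o -> A x ->
  is_segment A o x phi -> is_segment A o y psi ->
  0 <= t <= mdist o x -> t <= mdist o y -> phi t = psi t ->
  forall s, 0 <= s <= t -> phi s = psi s.
Proof.
move=> [uniq _] Ao Ax sphi spsi t01 ty E s s01.
have Ap : A (phi t) by case: sphi => _ _ + _; apply; rewrite in_itv.
have ty01 : 0 <= t <= mdist o y by rewrite ty; case/andP: t01 => ->.
have [chi [_ chiE]] := uniq o (phi t) Ao Ap.
have D := segment_dist0 sphi t01.
have sI : s \in `[0, mdist o (phi t)] by rewrite D in_itv.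
rewrite (chiE _ (segment_prefix sphi t01) _ sI).
by rewrite E in chiE sI *; rewrite (chiE _ (segment_prefix spsi ty01) _ sI).
Qed.

Lemma lipschitz_within (kappa : R -> X) (k : R) : 0 <= k ->
  (forall s t, 0 <= s -> s <= t -> t <= 1 ->
     mdist (kappa s) (kappa t) <= k * (t - s)) ->
  {within `[0, 1], continuous kappa}.
Proof.
move=> k0 lip; apply/subspace_continuousP => x /=.
rewrite in_itv/= => /andP[x0 x1].
apply/metricType_numDomainType.cvgrPdist_lt => e e0.
near=> t.
have : t \in `[0, 1] by near: t; exact: withinT.
rewrite in_itv/= => /andP[t0 t1].
have xt : `|x - t| < e / (k + 1).
  near: t; apply: cvg_within.
  apply: (@cvgr_dist_lt _ _ _ (nbhs x) _ id x) => //.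
  by rewrite divr_gt0// ltr_wpDl.
have {}xt : (k + 1) * `|x - t| < e.
  by rewrite mulrC -ltr_pdivlMr// ltr_wpDl.
have kx : k * `|x - t| <= (k + 1) * `|x - t| by rewrite ler_wpM2r// lerDl.
apply: le_lt_trans (le_lt_trans kx xt).
have [xlt|xgt] := leP x t.
  by rewrite distrC ger0_norm ?subr_ge0// lip.
by rewrite mdist_sym gtr0_norm ?subr_gt0// lip// ltW.
Unshelve. all: by end_near. Qed.

(** Let t be the last parameter at which the two geodesics from [o] meet.
    Going back from x to the meeting point and then on to y is an injective
    path, since on each geodesic the distance to [o] determines the point.  By
    the second axiom of trees it has the same image as the geodesic from x to
    y, which therefore passes through the meeting point; this identifies t
    with the Gromov product. *)
Lemma branch_point A o x y phi psi : is_tree A -> A o -> A x -> A y ->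
  is_segment A o x phi -> is_segment A o y psi ->
  phi (gromov_product o x y) = psi (gromov_product o x y).
Proof.
move=> tA Ao Ax Ay sphi spsi.
have [phi0 phi1 Aphi _] := sphi; have [psi0 psi1 Apsi _] := spsi.
pose S := [set t | [/\ 0 <= t, t <= mdist o x, t <= mdist o y & phi t = psi t]].
have S0 : S 0 by split; rewrite ?mdist_ge0// phi0 psi0.
have Sub : ubound S (mdist o x) by move=> t [].
have hS : has_sup S by split; [exists 0|exists (mdist o x)].
pose t := sup S.
have ubS s : S s -> s <= t by move=> Ss; exact: (sup_upper_bound hS Ss).
have t0 : 0 <= t by exact: ubS.
have tx : t <= mdist o x by apply: ge_sup => //; exists 0.
have ty : t <= mdist o y by apply: ge_sup; [exists 0|move=> s []].
have Et : phi t = psi t.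
  apply/mdist_positivity/eqP; rewrite eq_le mdist_ge0 andbT.
  apply/ler_addgt0Pr => e e0; rewrite add0r.
  have e20 : 0 < e / 2 by rewrite divr_gt0.
  have [s Ss ts] := sup_adherent e20 hS; rewrite -/t in ts.
  have st := ubS _ Ss; case: Ss => s0 sx sy Es.
  have := mdist_triangle (phi t) (phi s) (psi t).
  rewrite {2}Es (segment_dist sphi) ?(segment_dist spsi) ?t0 ?s0//.
  by rewrite ger0_norm ?subr_ge0// ler0_norm ?subr_le0//; lra.
suff xy : mdist x y = mdist o x + mdist o y - t *+ 2.
  have -> // : gromov_product o x y = t.
  by rewrite /gromov_product xy; lra.
have [u Eu] : exists u, u = mdist o x - t by eexists.
have [w Ew] : exists w, w = mdist o y - t by eexists.
have [/eqP uw0|uw0] := boolP (u + w == 0).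
  have xt : mdist o x = t by lra.
  have yt : mdist o y = t by lra.
  have -> : x = y by rewrite -phi1 -psi1 xt yt.
  by rewrite mdistxx yt; lra.
have {}uw0 : 0 < u + w by rewrite lt_neqAle eq_sym uw0/=; lra.
(* The concatenated path, parametrized by arc length. *)
pose sigma s := if s <= u then phi (mdist o x - s) else psi (t + (s - u)).
pose kappa s := sigma (s * (u + w)).
have sigma_lip s s' : 0 <= s -> s <= s' -> s' <= u + w ->
    mdist (sigma s) (sigma s') <= s' - s.
  move=> s0 ss' s'1; rewrite /sigma.
  have phiD v v' : 0 <= v -> v <= v' -> v' <= u ->
      mdist (phi (mdist o x - v)) (phi (mdist o x - v')) = v' - v.
    move=> *.
    by rewrite (segment_dist sphi) ?ger0_norm; try (apply/andP; split); lra.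
  have psiD v v' : u <= v -> v <= v' -> v' <= u + w ->
      mdist (psi (t + (v - u))) (psi (t + (v' - u))) = v' - v.
    move=> *.
    by rewrite (segment_dist spsi) ?ler0_norm; try (apply/andP; split); lra.
  have [su|us] := leP s u; have [s'u|us'] := leP s' u.
  - by rewrite phiD.
  - apply: le_trans (mdist_triangle _ (phi t) _) _.
    have /= := phiD s u s0 su (lexx _); have -> : mdist o x - u = t by lra.
    have /= := psiD u s' (lexx _) (ltW us') s'1; rewrite subrr addr0 -Et.
    by move=> -> ->; lra.
  - by lra.
  - by rewrite psiD// ltW.
have Dphi s : 0 <= s <= mdist o x -> mdist o (phi s) = s.
  by move=> ?; rewrite (segment_dist0 sphi).
have Dpsi s : 0 <= s <= mdist o y -> mdist o (psi s) = s.
  by move=> ?; rewrite (segment_dist0 spsi).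
have sigma_inj s s' : 0 <= s -> s <= s' -> s' <= u + w ->
    sigma s = sigma s' -> s = s'.
  move=> s0 ss' s'1; rewrite /sigma.
  have [su|us] := leP s u; have [s'u|us'] := leP s' u.
  - move=> /(congr1 (mdist o)); rewrite !Dphi; first by lra.
    + by apply/andP; split; lra.
    + by apply/andP; split; lra.
  - move=> E; have := congr1 (mdist o) E; rewrite Dphi ?Dpsi.
    + move=> E'; rewrite -E' in E.
      have : mdist o x - s <= t.
        apply: ubS; split=> //.
        * by lra.
        * by lra.
        * by lra.
      by lra.
    + by apply/andP; split; lra.
    + by apply/andP; split; lra.
  - by lra.
  - move=> /(congr1 (mdist o)); rewrite !Dpsi; first by lra.
    + by apply/andP; split; lra.
    + by apply/andP; split; lra.
have scale s : 0 <= s -> s <= 1 -> 0 <= s * (u + w) /\ s * (u + w) <= u + w.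
  by move=> s0 s1; split; [rewrite mulr_ge0// ltW|rewrite ler_piMl// ltW].
have kcont : {within `[0, 1], continuous kappa}.
  apply: (@lipschitz_within _ (u + w)); first exact: ltW.
  move=> s s' s0 ss' s'1; have [? ?] := scale _ (le_trans s0 ss') s'1.
  have [? ?] := scale _ s0 (le_trans ss' s'1).
  apply: le_trans (sigma_lip _ _ _ _ _) _ => //; first by rewrite ler_wpM2r// ltW.
  by lra.
have kinj : {in `[0, 1] &, injective kappa}.
  move=> s s'; rewrite !in_itv/= => /andP[s0 s1] /andP[s'0 s'1] E.
  have [? ?] := scale _ s0 s1; have [? ?] := scale _ s'0 s'1.
  apply: (mulIf (lt0r_neq0 uw0)).
  have [ss'|/ltW ss'] := leP (s * (u + w)) (s' * (u + w)).
    exact: sigma_inj.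
  by apply/esym; apply: sigma_inj.
have kA : kappa @` `[0, 1] `<=` A.
  move=> _ [s + <-]; rewrite /= in_itv/= => /andP[s0 s1].
  have [? ?] := scale _ s0 s1; rewrite /kappa /sigma.
  have [su|us] := leP (s * (u + w)) u.
    by apply: Aphi; rewrite in_itv/=; apply/andP; split; lra.
  by apply: Apsi; rewrite in_itv/=; apply/andP; split; lra.
have k0 : kappa 0 = x.
  by rewrite /kappa /sigma mul0r subr0 phi1 ifT//; lra.
have k1 : kappa 1 = y.
  rewrite /kappa /sigma mul1r; have [w0|_] := leP.
    have yt : mdist o y = t by lra.
    have -> : mdist o x - (u + w) = t by lra.
    by rewrite Et -[in RHS]psi1 yt.
  by have -> : t + (u + w - u) = mdist o y by lra.
have [chi [schi _]] := tA.1 _ _ Ax Ay.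
have := tA.2 kappa kcont kinj kA; rewrite k0 k1 => /(_ _ schi) imE.
(* The meeting point is on the path, hence on the geodesic from x to y. *)
have : (kappa @` `[0, 1]) (phi t).
  exists (u / (u + w)).
    rewrite /= in_itv/= divr_ge0 ?(ltW uw0) ?Eu ?subr_ge0//= -Eu.
    by rewrite ler_pdivrMr// mul1r; lra.
  rewrite /kappa /sigma divfK ?gt_eqF// lexx; congr phi; lra.
rewrite imE => -[s]; rewrite /= in_itv/= => sI E.
have := segment_dist0 schi sI; have := segment_dist1 schi sI.
rewrite E (mdist_sym x (phi t)).
rewrite (segment_dist1 sphi) ?t0// Et (segment_dist1 spsi) ?t0//.
by move=> *; lra.
Qed.

(** Up to the smaller of the two products, the geodesics from [o] to x, a and
    y share their points, and the path from x to y through the last shared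
    point bounds the distance from x to y. *)
Lemma tree_hyperbolic A o x y a : is_tree A -> A o -> A x -> A y -> A a ->
  Num.min (gromov_product o x a) (gromov_product o y a) <= gromov_product o x y.
Proof.
move=> tA Ao Ax Ay Aa.
have [phi [sphi _]] := tA.1 _ _ Ao Ax; have [psi [spsi _]] := tA.1 _ _ Ao Ay.
have [chi [schi _]] := tA.1 _ _ Ao Aa.
set s := Num.min _ _.
have xa := branch_point tA Ao Ax Aa sphi schi.
have ya := branch_point tA Ao Ay Aa spsi schi.
have sx : s <= gromov_product o x a by rewrite ge_min lexx.
have sy : s <= gromov_product o y a by rewrite ge_min lexx orbT.
have s0 : 0 <= s by rewrite le_min !gromov_ge0.
have Ex : phi s = chi s.
  apply: (segment_agree tA Ao Ax sphi schi _ _ xa); rewrite ?s0//.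
  - by rewrite gromov_ge0 gromov_le.
  - by rewrite gromovC gromov_le.
have Ey : psi s = chi s.
  apply: (segment_agree tA Ao Ay spsi schi _ _ ya); rewrite ?s0//.
  - by rewrite gromov_ge0 gromov_le.
  - by rewrite gromovC gromov_le.
have := mdist_triangle x (phi s) y; rewrite {2}Ex -Ey (mdist_sym x (phi s)).
rewrite (segment_dist1 sphi); last first.
  by rewrite s0 (le_trans sx)// gromov_le.
rewrite (segment_dist1 spsi); last first.
  by rewrite s0 (le_trans sy)// gromov_le.
by rewrite /gromov_product; lra.
Qed.

End Trees.

(** * Integrals of functions not known to be measurable *)

Section Integrals.
Context d (T : measurableType d) (R : realType).
Variable m : {measure set T -> \bar R}.
Local Open Scope ereal_scope.

(** The integral of a nonnegative function is a supremum over the simple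
    functions below it, which makes it monotone without any measurability.
    This lets the Besov energy be estimated although the inner integral is not
    shown to be measurable in the outer variable. *)
Lemma ge0_le_integral_any (D : set T) (f g : T -> \bar R) :
  (forall x, D x -> 0 <= f x <= g x) ->
  \int[m]_(x in D) f x <= \int[m]_(x in D) g x.
Proof.
move=> fg; have f0 x : D x -> 0 <= f x by move=> /fg/andP[].
have g0 x : D x -> 0 <= g x by move=> /fg/andP[]; exact: le_trans.
rewrite !ge0_integralE//; apply: le_ereal_sup => _ [h /= hf <-].
exists h => // x; apply: le_trans (hf x) _.
rewrite !patchE; case: ifPn => //; rewrite inE => /fg.
by case/andP.
Qed.

Lemma integral_ge_steps (n : nat) (H : nat -> set T) (w : nat -> R)
    (g : T -> \bar R) :
  (forall i, (i < n)%N -> measurable (H i)) ->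
  trivIset [set i | (i < n)%N] H ->
  (forall i, (i < n)%N -> (0 <= w i)%R) ->
  (forall i x, (i < n)%N -> H i x -> (w i)%:E <= g x) ->
  (forall x, 0 <= g x) ->
  \sum_(i < n) (w i)%:E * m (H i) <= \int[m]_x g x.
Proof.
move=> mH tH w0 wg g0.
have -> : \sum_(i < n) (w i)%:E * m (H i) =
    \int[m]_x \sum_(i < n) (w i)%:E * (\1_(H i) x)%:E.
  rewrite ge0_integral_sum//.
  - apply: eq_bigr => i _; rewrite ge0_integralZl//.
    + by rewrite integral_indic ?setIT//; exact: mH.
    + by apply/measurable_EFinP; apply: measurable_indic; exact: mH.
    + by rewrite lee_fin w0.
  - move=> i; apply: measurable_funeM.
    by apply/measurable_EFinP; apply: measurable_indic; exact: mH.
  - by move=> i x _; rewrite mule_ge0// lee_fin w0.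
apply: ge0_le_integral_any => x _; apply/andP; split.
  by apply: sume_ge0 => i _; rewrite mule_ge0// lee_fin w0.
have [[i Hix]|nH] := pselect (exists i : 'I_n, H i x).
  rewrite (bigD1 i)//= big1 => [|j ji].
    by rewrite adde0 indicE mem_set// mule1 wg.
  rewrite indicE memNset ?mule0// => Hjx.
  move/eqP: ji; apply; apply/val_inj/(tH _ _ (ltn_ord j) (ltn_ord i)).
  by exists x.
rewrite big1 // => i _; rewrite indicE memNset ?mule0// => Hix.
by apply: nH; exists i.
Qed.

Lemma measure_bigcup_le (F : nat -> set T) (q : \bar R) :
  (forall n, measurable (F n)) -> nondecreasing_seq F ->
  (forall n, m (F n) <= q) -> m (\bigcup_n F n) <= q.
Proof.
move=> mF ndF Fq.
have cF := nondecreasing_cvg_mu (mu := m) mF (bigcupT_measurable _ mF) ndF.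
rewrite -(cvg_lim _ cF)//; apply: lime_le; first by apply/cvg_ex; eexists; exact: cF.
exact: nearW.
Qed.

End Integrals.

(** * Medians *)

Section Median.
Context d (T : measurableType d) (R : realType).
Variable m : {measure set T -> \bar R}.
Variables (B : set T) (b : R) (f : T -> R).
Hypotheses (mB : measurable B) (mBb : m B = b%:E) (b0 : 0 < b).
Hypothesis mf : measurable_fun setT f.

Lemma measurable_level (A : set R) : measurable A -> measurable (f @^-1` A).
Proof. by move=> mA; rewrite -[_ @^-1` _]setTI; exact: mf. Qed.

Lemma level_le c : [set x | f x <= c] = f @^-1` `]-oo, c].
Proof. by apply/funext => x; rewrite /preimage/= in_itv. Qed.

Lemma level_ge c : [set x | c <= f x] = f @^-1` `[c, +oo[.
Proof. by apply/funext => x; rewrite /preimage/= in_itv/= andbT. Qed.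

Lemma measure_level_split (A : set R) : measurable A ->
  (m (B `&` f @^-1` A) + m (B `&` f @^-1` (~` A)) = b%:E)%E.
Proof.
move=> mA; rewrite -mBb -[in RHS](setIT B) -(preimage_setT f) -(setUv A).
rewrite preimage_setU setIUr; apply/esym/measureU.
- by apply: measurableI => //; exact: measurable_level.
- by apply: measurableI => //; apply: measurable_level; exact: measurableC.
- by rewrite -setIIr -preimage_setI setICr preimage_set0 setI0.
Qed.

Let small (A : set R) := (m (B `&` f @^-1` A) <= (b / 2)%:E)%E.

Let small_compl A : measurable A -> ~~ small A -> small (~` A).
Proof.
move=> mA; rewrite /small -ltNge => Ab; rewrite leNgt; apply/negP => AC.
have := lteD Ab AC; rewrite measure_level_split// -EFinD lte_fin -splitr ltxx.
by [].
Qed.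

Let smallS A A' : measurable A -> measurable A' -> A `<=` A' ->
  small A' -> small A.
Proof.
move=> mA mA' AA'; apply: le_trans.
rewrite le_measure ?inE//; [| |by apply: setIS; exact: preimage_subset].
  by apply: measurableI => //; exact: measurable_level.
by apply: measurableI => //; exact: measurable_level.
Qed.

Let small_bigcup (A : nat -> set R) : (forall n, measurable (A n)) ->
  nondecreasing_seq A -> (forall n, small (A n)) -> small (\bigcup_n A n).
Proof.
move=> mA ndA sA; rewrite /small preimage_bigcup setI_bigcupr.
apply: measure_bigcup_le => [n|n n' nn'|n]; last exact: sA.
  by apply: measurableI => //; exact: measurable_level.
apply/subsetPset; apply: setIS; apply: preimage_subset; apply/subsetPset.
exact: ndA.
Qed.

Let smallT : ~~ small setT.
Proof. by rewrite /small preimage_setT setIT mBb -ltNge lte_fin gtr_pMr// invf_lt1// ltr1n. Qed.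

(** The infimum of the t such that [{f > t}] has at most half of the mass is
    a median: the sets strictly above and strictly below it are increasing
    unions of sets with at most half of the mass. *)
Lemma exists_median : exists mu : R,
  ((b / 2)%:E <= m (B `&` [set x | (f x <= mu)%R]))%E /\
  ((b / 2)%:E <= m (B `&` [set x | (mu <= f x)%R]))%E.
Proof.
pose S := [set t : R | small `]t, +oo[].
have upS s t : s <= t -> S s -> S t.
  move=> st; apply: smallS => // x; rewrite /= !in_itv/= !andbT.
  exact: le_lt_trans.
have S0 : S !=set0.
  apply: contrapT => /set0P/negP/negPn/eqP S0; move/negP: smallT; apply.
  rewrite (_ : setT = \bigcup_(n : nat) `]-oo, n%:R : R]%classic); last first.
    apply/esym/seteqP; split => // x _; exists (Num.truncn `|x|).+1 => //=.
    rewrite in_itv/=; apply: le_trans (ler_norm x) _.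
    by apply/ltW; exact: truncnS_gt.
  apply: small_bigcup => // [i j ij|n].
    apply/subsetPset => x; rewrite /= !in_itv/= => /le_trans; apply.
    by rewrite ler_nat.
  rewrite -[X in small X]setCK setCitvl; apply: small_compl => //.
  by apply/negP => nS; have : S n%:R by []; rewrite S0.
have lS : has_lbound S.
  apply: contrapT => nS; move/negP: smallT; apply.
  rewrite (_ : setT = \bigcup_(n : nat) `]- n%:R : R, +oo[%classic); last first.
    apply/esym/seteqP; split => // x _; exists (Num.truncn `|x|).+1 => //=.
    rewrite in_itv/= andbT ltrNl; apply: le_lt_trans (truncnS_gt _).
    by rewrite -normrN ler_norm.
  apply: small_bigcup => // [i j ij|n].
    apply/subsetPset => x; rewrite /= !in_itv/= !andbT; apply: le_lt_trans.
    by rewrite lerN2 ler_nat.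
  apply: contrapT => nSn; apply: nS; exists (- n%:R) => s Ss.
  by rewrite leNgt; apply/negP => /ltW/upS/(_ Ss).
have hS : has_inf S by split.
exists (inf S).
have gt_mu : small `]inf S, +oo[.
  rewrite (_ : `]inf S, +oo[%classic =
      \bigcup_(n : nat) `]inf S + n.+1%:R^-1, +oo[%classic); last first.
    apply/seteqP; split => [x|x [n _]]; rewrite /= !in_itv/= !andbT; last first.
      by apply: le_lt_trans; rewrite lerDl.
    rewrite -subr_gt0 => xS; exists (Num.truncn (x - inf S)^-1) => //=.
    rewrite in_itv/= andbT -ltrBrDl invf_plt ?posrE//.
    exact: truncnS_gt.
  apply: small_bigcup => // [i j ij|n].
    apply/subsetPset => x; rewrite /= !in_itv/= !andbT; apply: le_lt_trans.
    by rewrite lerD2l lef_pV2 ?posrE// ler_nat ltnS.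
  have n0 : 0 < (n.+1%:R^-1 : R) by [].
  by have [s Ss /ltW/upS] := inf_adherent n0 hS; exact.
have lt_mu : small `]-oo, inf S[.
  rewrite (_ : `]-oo, inf S[%classic =
      \bigcup_(n : nat) `]-oo, inf S - n.+1%:R^-1]%classic); last first.
    apply/seteqP; split => [x|x [n _]]; rewrite /= !in_itv/=; last first.
      by move=> /le_lt_trans; apply; rewrite ltrBlDr ltrDl.
    rewrite -subr_gt0 => xS; exists (Num.truncn (inf S - x)^-1) => //=.
    rewrite in_itv/= lerBrDr -lerBrDl invf_ple ?posrE//.
    exact/ltW/truncnS_gt.
  apply: small_bigcup => // [i j ij|n].
    apply/subsetPset => x; rewrite /= !in_itv/= => /le_trans; apply.
    by rewrite lerD2l lerN2 lef_pV2 ?posrE// ler_nat ltnS.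
  rewrite -[X in small X]setCK setCitvl; apply: small_compl => //.
  apply/negP => Sn; have := inf_lbound hS.2 Sn.
  by rewrite leNgt ltrBlDr ltrDl invr_gt0 ltr0n.
have half A : measurable A -> small (~` A) ->
    ((b / 2)%:E <= m (B `&` f @^-1` A))%E.
  move=> mA sC; rewrite leNgt; apply/negP => sA.
  have := lte_leD _ sA sC; rewrite measure_level_split// -EFinD lte_fin.
  rewrite -splitr ltxx ge0_fin_numE ?measure_ge0// (le_lt_trans sC) ?ltry//.
  by move=> /(_ isT).
rewrite level_le level_ge; split; apply: half => //.
- by rewrite setCitvl.
- by rewrite setCitvr.
Qed.

Lemma measurable_deviation (c t : R) :
  measurable (B `&` [set x | (t < `|f x - c|)%R]).
Proof.
apply: measurableI => //.
rewrite (_ : [set x | _] = (fun x => `|f x - c|) @^-1` `]t, +oo[); last first.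
  by apply/funext => x; rewrite /preimage/= in_itv/= andbT.
rewrite -[_ @^-1` _]setTI; apply: measurableT_comp => //.
exact: measurable_funB.
Qed.

(** The constant c may vary with [delta], but as soon as [delta] is less than
    half of the mass it lies within [delta] of any median, because the set where
    f is within [delta] of c meets both halves.  So f equals its median a.e. *)
Lemma ae_constant_of_concentration :
  (forall delta : R, 0 < delta -> exists c : R,
     (m (B `&` [set x | (delta < `|f x - c|)%R]) <= delta%:E)%E) ->
  exists c : R, m (B `&` [set x | f x <> c]) = 0%E.
Proof.
move=> conc; have [mu [le_mu ge_mu]] := exists_median.
have mdev := measurable_deviation.
have mle : measurable (B `&` [set x | (f x <= mu)%R]).
  apply: measurableI => //.
  by rewrite level_le; exact: measurable_level.
have mge : measurable (B `&` [set x | (mu <= f x)%R]).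
  apply: measurableI => //.
  by rewrite level_ge; exact: measurable_level.
exists mu.
rewrite (_ : B `&` _ =
  \bigcup_n (B `&` [set x | (n.+1%:R^-1 < `|f x - mu|)%R])); last first.
  apply/seteqP; split => [x [Bx] /= /eqP|x [n _ [Bx]]].
    rewrite -subr_eq0 -normr_gt0 => fx; exists (Num.truncn `|f x - mu|^-1) => //; split => //=.
    by rewrite invf_plt ?posrE// truncnS_gt.
  move=> /= lt; split => //= E; move: lt.
  by rewrite E subrr normr0 ltNge invr_ge0 ler0n.
apply/eqP; rewrite eq_le measure_ge0 andbT.
apply: measure_bigcup_le => // [i j ij|n].
  apply/subsetPset => x [Bx] /= ltx; split => //=; apply: le_lt_trans ltx.
  by rewrite lef_pV2 ?posrE// ler_nat ltnS.
apply/lee_addgt0Pr => e e0; rewrite add0e.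
pose delta := Num.min e (Num.min (b / 4) (n.+1%:R^-1 / 2)).
have d0 : 0 < delta by rewrite !lt_min e0 !divr_gt0.
have de : delta <= e by rewrite ge_min lexx.
have db : delta <= b / 4 by rewrite !ge_min lexx orbT.
have dn : delta <= n.+1%:R^-1 / 2 by rewrite !ge_min lexx !orbT.
have [c dc] := conc _ d0.
have muc : `|mu - c| <= delta.
  rewrite leNgt; apply/negP => ltmu.
  suff : ((b / 2)%:E <= delta%:E)%E by rewrite lee_fin; lra.
  have [cmu|muc] := leP c mu.
    apply: le_trans ge_mu (le_trans _ dc); rewrite le_measure ?inE// => x [Bx /= fx].
    split => //=; apply: lt_le_trans ltmu _.
    by rewrite !ger0_norm; lra.
  apply: le_trans le_mu (le_trans _ dc); rewrite le_measure ?inE// => x [Bx /= fx].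
  split => //=; apply: lt_le_trans ltmu _.
  by rewrite !ler0_norm; lra.
have : (delta%:E <= e%:E)%E by rewrite lee_fin.
apply: le_trans; apply: le_trans dc; rewrite le_measure ?inE// => x [Bx /= fx].
split => //=; have := ler_distD c (f x) mu; rewrite (distrC c mu).
have arith (u v w h k : R) :
  k <= h / 2 -> h < u -> v <= k -> u <= w + v -> k < w by lra.
exact: arith dn fx muc.
Qed.

End Median.

(** * Power estimates *)

Section Powers.
Context {R : realType}.
Implicit Types (p q t tau : R).

(** A substitute for the inequality of Hoelder for finite sums: summed over n
    terms, with a good choice of [tau], it bounds a sum by the sum of the p-th
    powers. *)
Lemma le_linear_powR p t tau : 1 <= p -> 0 <= t -> 0 < tau ->
  t <= tau + tau `^ (1 - p) * t `^ p.
Proof.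
move=> p1 t0 tau0; have P0 : 0 <= tau `^ (1 - p) * t `^ p.
  by rewrite mulr_ge0 ?powR_ge0.
have [tt|tt] := leP t tau; first by lra.
rewrite (@le_trans _ _ (tau `^ (1 - p) * t `^ p)) ?lerDr ?(ltW tau0)//.
have tt1 : 1 <= t / tau by rewrite ler_pdivlMr// mul1r ltW.
have -> : tau `^ (1 - p) * t `^ p = tau * (t / tau) `^ p.
  rewrite powRB ?(gt_eqF tau0) ?implybT// powRr1 ?ltW//.
  have tauV : tau^-1 `^ p = (tau `^ p)^-1.
    by rewrite -powR_inv1 ?ltW// -powRrM mulN1r powRN.
  by rewrite powRM ?invr_ge0 ?(ltW tau0)// tauV; ring.
rewrite mulrC -ler_pdivrMr//.
by apply: le1r_powR.
Qed.

Lemma small_powR (B q delta : R) : 0 <= B -> 0 < q -> 0 < delta ->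
  exists2 rho : R, 0 < rho & forall r, 0 < r -> r < rho -> B * r `^ q <= delta.
Proof.
move=> B0 q0 d0; have dB : 0 < delta / (B + 1) by rewrite divr_gt0// ltr_wpDl.
exists ((delta / (B + 1)) `^ q^-1) => [|r r0 rlt]; first exact: powR_gt0.
have : r `^ q <= delta / (B + 1).
  have -> : delta / (B + 1) = ((delta / (B + 1)) `^ q^-1) `^ q.
    by rewrite -powRrM mulVf ?gt_eqF// powRr1 ?ltW.
  by rewrite ge0_ler_powR ?nnegrE ?(ltW q0) ?(ltW r0) ?powR_ge0 ?(ltW rlt)//.
rewrite ler_pdivlMr ?ltr_wpDl// => /(le_trans _); apply.
by rewrite mulrC ler_wpM2l ?powR_ge0// lerDl.
Qed.

End Powers.

(** * The Besov density *)

Section Density.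
Context {R : realType} {X : pmetricType R}.
Variable m : {measure set (borel X) -> \bar R}.
Implicit Types (x y : X) (r p a : R) (f : borel X -> R).

Lemma measurable_metric_ball x r : measurable (ball x r : set (borel X)).
Proof. by apply: sub_sigma_algebra; exact: ball_is_open. Qed.

Definition besov_density p a f r x : \bar R :=
  ((m (ball x r))^-1 *
    \int[m]_(y in ball x r) (`|f y - f x| `^ p / r `^ (p * a))%:E)%E.

Lemma besov_density_ge0 p a f r x : (0 <= besov_density p a f r x)%E.
Proof.
rewrite mule_ge0 ?inve_ge0//; apply: integral_ge0 => y _.
by rewrite lee_fin divr_ge0 ?powR_ge0.
Qed.

Lemma besov_density_ge p a f r x (D : set (borel X)) (V v k : R) :
  0 <= p -> 0 < V -> (m (ball x r) <= V%:E)%E ->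
  measurable D -> D `<=` ball x r -> (v%:E <= m D)%E -> 0 <= v -> 0 <= k ->
  (forall y, D y -> k <= `|f y - f x|) ->
  ((V^-1 * (k `^ p / r `^ (p * a) * v))%:E <= besov_density p a f r x)%E.
Proof.
move=> p0 V0 mV mD Dr vD v0 k0 kf.
have c0 : 0 <= k `^ p / r `^ (p * a) by rewrite divr_ge0 ?powR_ge0.
rewrite EFinM; apply: lee_pmul.
- by rewrite lee_fin invr_ge0 ltW.
- by rewrite lee_fin mulr_ge0.
- have -> : (V^-1)%:E = ((V%:E)^-1)%E by rewrite inver gt_eqF.
  by rewrite lee_pV2 ?inE ?lee_fin ?(ltW V0)//.
apply: (@le_trans _ _ (\int[m]_(y in ball x r)
    ((k `^ p / r `^ (p * a))%:E * (\1_D y)%:E))%E).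
  have mb := measurable_metric_ball x r.
  rewrite ge0_integralZl//.
  - rewrite integral_indic// setIidl// EFinM lee_pmul ?lee_fin//.
  - by apply/measurable_EFinP; exact: measurable_indic.
apply: ge0_le_integral_any => y _; apply/andP; split.
  by rewrite mule_ge0// lee_fin.
rewrite indicE; case: (boolP (y \in D)) => [|_].
  rewrite inE mule1 lee_fin => /kf ky; rewrite ler_wpM2r ?invr_ge0 ?powR_ge0//.
  by rewrite ge0_ler_powR ?nnegrE.
by rewrite mule0 lee_fin divr_ge0 ?powR_ge0.
Qed.

End Density.

(** * Rigidity above the critical exponent *)

Section Rigidity.
Context {R : realType} {X : pmetricType R}.
Variable m : {measure set (borel X) -> \bar R}.
Variables (r0 c C dh p a M rad : R) (f : borel X -> R).
Hypotheses (r0_gt0 : 0 < r0) (c_gt0 : 0 < c) (C_gt0 : 0 < C).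
Hypothesis volume : forall (x : X) (r : R), 0 < r < r0 ->
  ((c * r `^ dh)%:E <= m (ball x r) <= (C * r `^ dh)%:E)%E.
Hypothesis p_ge1 : 1 <= p.
Hypothesis mf : measurable_fun setT f.
Hypothesis energy : forall r, 0 < r < 1 -> (besov_energy m p a f r <= M%:E)%E.
Implicit Types (x y o : X) (r : R).

(** The loss in the volume ratio and in the scale when a half of a ball of
    radius r is seen from a ball of radius 4 r. *)
Let K := c / (2 * C * 4 `^ (dh + p * a)).
Let K_gt0 : 0 < K.
Proof. by rewrite divr_gt0// !mulr_gt0// powR_gt0. Qed.

Let p_ge0 : 0 <= p. Proof. by apply: le_trans p_ge1. Qed.

Definition admissible r := [/\ 0 < r, 4 * r < r0 & 4 * r < 1].

Lemma density_ge r x (D : set (borel X)) (k : R) : admissible r ->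
  measurable D -> D `<=` ball x (4 * r) -> ((c * r `^ dh / 2)%:E <= m D)%E ->
  0 <= k -> (forall y, D y -> k <= `|f y - f x|) ->
  ((K * k `^ p / r `^ (p * a))%:E <= besov_density m p a f (4 * r) x)%E.
Proof.
move=> [r_gt0 rr0 r1] mD Dr vD k0 kf.
have r40 : 0 < 4 * r < r0 by rewrite rr0 mulr_gt0.
have /andP[_ mV] := volume x r40.
have V0 : 0 < C * (4 * r) `^ dh by rewrite mulr_gt0// powR_gt0// mulr_gt0.
have v0 : 0 <= c * r `^ dh / 2 by rewrite divr_ge0// mulr_ge0 ?powR_ge0 ?ltW.
have := besov_density_ge a p_ge0 V0 mV mD Dr vD v0 k0 kf.
apply: le_trans; rewrite lee_fin le_eqVlt; apply/orP; left; apply/eqP.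
rewrite !powRM ?(ltW r_gt0)// /K powRD ?pnatr_eq0 ?implybT//.
have F (z : R) : 4 `^ z != 0 :> R by rewrite gt_eqF// powR_gt0.
have G (z : R) : r `^ z != 0 by rewrite gt_eqF// powR_gt0.
by field; rewrite !F !G lt0r_neq0.
Qed.

(** Half of the lower volume bound stands for half of the mass of the ball, so
    that the condition is uniform in x. *)
Definition is_median r x (mu : R) :=
  ((c * r `^ dh / 2)%:E <= m (ball x r `&` [set y | (f y <= mu)%R]))%E /\
  ((c * r `^ dh / 2)%:E <= m (ball x r `&` [set y | (mu <= f y)%R]))%E.

Lemma median_function r : 0 < r < r0 ->
  exists g : X -> R, forall x, is_median r x (g x).
Proof.
move=> r00; suff /choice[g gP] : forall x, exists mu, is_median r x mu by exists g.
move=> x; have /andP[lo hi] := volume x r00.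
have fin : m (ball x r) \is a fin_num.
  by rewrite ge0_fin_numE// (le_lt_trans hi)// ltry.
have b_ge : c * r `^ dh <= fine (m (ball x r)) by rewrite -lee_fin fineK.
have b0 : 0 < fine (m (ball x r)).
  by apply: lt_le_trans b_ge; rewrite mulr_gt0// powR_gt0//; case/andP: r00.
have [mu [le_mu ge_mu]] :=
  exists_median (measurable_metric_ball x r) (esym (fineK fin)) b0 mf.
by exists mu; split; [apply: le_trans le_mu|apply: le_trans ge_mu];
  rewrite lee_fin ler_pM2r ?invr_gt0.
Qed.

Lemma measurable_half x r mu (b : bool) : measurable
  (ball x r `&` (if b then [set y | f y <= mu] else [set y | mu <= f y])
   : set (borel X)).
Proof.
apply: measurableI; first exact: measurable_metric_ball.
case: b; first by rewrite level_le; exact: (measurable_level mf).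
by rewrite level_ge; exact: (measurable_level mf).
Qed.

Lemma energy_steps r (n : nat) (H : nat -> set (borel X)) (k : nat -> R) :
  admissible r ->
  (forall i, (i < n)%N -> measurable (H i)) ->
  trivIset [set i | (i < n)%N] H ->
  (forall i x, (i < n)%N -> H i x -> exists D : set (borel X),
    [/\ measurable D, D `<=` ball (x : X) (4 * r),
        ((c * r `^ dh / 2)%:E <= m D)%E &
        (forall y, D y -> k i <= `|f y - f x|)]) ->
  (forall i, (i < n)%N -> 0 <= k i) ->
  (\sum_(i < n) (K * k i `^ p / r `^ (p * a))%:E * m (H i) <= M%:E)%E.
Proof.
move=> rP mH tH HD k0; case: (rP) => r_gt0 rr0 r1.
have r41 : 0 < 4 * r < 1 by rewrite r1 mulr_gt0.
apply: le_trans (energy r41); apply: (@integral_ge_steps _ _ _ m n H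
  (fun i => K * k i `^ p / r `^ (p * a))) => //.
- by move=> i _; rewrite divr_ge0 ?powR_ge0// mulr_ge0 ?powR_ge0// ltW.
- move=> i x ilt Hix; have [D [mD Dr vD kD]] := HD _ _ ilt Hix.
  exact: (density_ge rP mD Dr vD (k0 _ ilt) kD).
- by move=> x; exact: besov_density_ge0.
Qed.

(** The half of the first ball where f is on the far side of [mu] and the half
    of the second ball where f is on the far side of [nu] are separated by the
    gap between the medians, and lie within 4 r of each other. *)
Lemma median_gap r x y mu nu : is_median r x mu -> is_median r y nu ->
  mdist x y <= 2 * r ->
  let b := mu <= nu in
  let H := ball x r `&` (if b then [set z | f z <= mu] else [set z | mu <= f z]) in
  ((c * r `^ dh / 2)%:E <= m H)%E /\
  forall z, H z -> exists D : set (borel X),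
    [/\ measurable D, D `<=` ball (z : X) (4 * r),
        ((c * r `^ dh / 2)%:E <= m D)%E &
        (forall y, D y -> `|mu - nu| <= `|f y - f z|)].
Proof.
move=> [mu1 mu2] [nu1 nu2] xy b H; split.
  by rewrite /H; case: (b).
move=> z [xz fz].
exists (ball y r `&` (if ~~ b then [set z | f z <= nu] else [set z | nu <= f z])).
split.
- exact: measurable_half.
- move=> w [yw _]; move: xz yw; rewrite !mdist_ball => xz yw.
  have := mdist_triangle z x w; have := mdist_triangle x y w.
  by rewrite (mdist_sym z x); lra.
- by case: (b).
- move=> w [_]; move: fz; rewrite /b; have [munu|numu] := leP mu nu => /= fz fw.
    rewrite ler0_norm ?subr_le0// ger0_norm; last first.
      by rewrite subr_ge0 (le_trans fz)// (le_trans munu).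
    by rewrite opprB lerB.
  rewrite ger0_norm ?subr_ge0 ?(ltW numu)// ler0_norm; last first.
    by rewrite subr_le0 (le_trans fw)// (le_trans (ltW numu)).
  by rewrite opprB lerB.
Qed.

(** The balls of radius r around points that are 2 r apart are disjoint, so all
    the gaps of a chain are charged to a single energy.  The last centre is
    exempt from the separation, because the final step of a chain may be
    short. *)
Lemma chain_energy r (n : nat) (z : nat -> X) (g : X -> R) : admissible r ->
  (forall x, is_median r x (g x)) ->
  (forall i, (i < n)%N -> mdist (z i) (z i.+1) <= 2 * r) ->
  (forall i j, (i < j < n)%N -> 2 * r <= mdist (z i) (z j)) ->
  \sum_(i < n) `|g (z i) - g (z i.+1)| `^ p <=
    2 * M / (K * c) * r `^ (p * a - dh).
Proof.
move=> rP gP step sep; case: (rP) => r_gt0 rr0 r1.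
pose b i := g (z i) <= g (z i.+1).
pose H i : set (borel X) := ball (z i) r `&`
  (if b i then [set y | f y <= g (z i)] else [set y | g (z i) <= f y]).
have gap i : (i < n)%N -> _ := fun ilt =>
  median_gap (gP (z i)) (gP (z i.+1)) (step _ ilt).
have tH : trivIset [set i | (i < n)%N] H.
  apply/trivIsetP => i j /= ilt jlt ij; rewrite -subset0 => x [[xi _] [xj _]].
  move: xi xj; rewrite !mdist_ball => xi xj.
  have : 2 * r <= mdist (z i) (z j).
    move: ij; rewrite neq_ltn => /orP[] lt_ij.
    - by apply: sep; rewrite lt_ij jlt.
    - by rewrite mdist_sym; apply: sep; rewrite lt_ij ilt.
  by have := mdist_triangle (z i) x (z j); rewrite (mdist_sym x); lra.
have := @energy_steps r n H (fun i => `|g (z i) - g (z i.+1)|) rP.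
move=> /(_ (fun i _ => measurable_half _ _ _ _) tH).
move=> /(_ (fun i x ilt => (gap i ilt).2 x) (fun i _ => normr_ge0 _)) le_M.
set S := \sum_(i < n) _.
have : K / r `^ (p * a) * (c * r `^ dh / 2) * S <= M.
  rewrite -lee_fin; apply: le_trans le_M; rewrite mulr_sumr -sumEFin.
  apply: lee_sum => i _.
  rewrite (_ : _ * _ = K * `|g (z i) - g (z i.+1)| `^ p / r `^ (p * a) *
    (c * r `^ dh / 2)); last by ring.
  rewrite EFinM lee_wpmul2l// ?(gap _ (ltn_ord i)).1//.
  by rewrite lee_fin divr_ge0 ?powR_ge0// mulr_ge0 ?powR_ge0// ltW.
have q0 : 0 < K / r `^ (p * a) * (c * r `^ dh / 2).
  apply: mulr_gt0; first by apply: divr_gt0; rewrite ?powR_gt0.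
  by apply: divr_gt0 => //; apply: mulr_gt0; rewrite ?powR_gt0.
rewrite mulrC -ler_pdivlMr// => /le_trans; apply.
rewrite le_eqVlt; apply/orP; left; apply/eqP.
rewrite powRB ?(gt_eqF r_gt0) ?implybT//.
have G (y : R) : r `^ y != 0 by rewrite gt_eqF// powR_gt0.
by field; rewrite !G !lt0r_neq0.
Qed.

Let excess := a - (1 + (dh - 1) / p).

(** The chain has about 1 / r steps.  With tau = r^(1 + excess), the first term
    of [le_linear_powR] contributes r^excess, and so does the second one, as
    (1 + excess) (1 - p) + (p a - dh) = excess. *)
Lemma medians_close A o x phi r (g : X -> R) : admissible r ->
  (forall x, is_median r x (g x)) -> is_segment A o x phi ->
  `|g o - g x| <= (mdist o x + 1 + 2 * M / (K * c)) * r `^ excess.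
Proof.
move=> rP gP seg; case: (rP) => r_gt0 rr0 r1.
have [L EL] : exists L, L = mdist o x by eexists.
have L0 : 0 <= L by rewrite EL mdist_ge0.
pose N := Num.truncn (L / (2 * r)).
have r2 : 0 < 2 * r by rewrite mulr_gt0.
have /andP[NL LN] : N%:R <= L / (2 * r) < N.+1%:R.
  by apply: truncn_itv; rewrite divr_ge0// ltW.
rewrite ler_pdivlMr// in NL; rewrite ltr_pdivrMr// in LN.
(* Steps of length 2 r, the last one being cut at x. *)
pose t (i : nat) : R := Num.min (i%:R * (2 * r)) L.
have tI i : 0 <= t i <= mdist o x.
  by rewrite -EL /t ge_min lexx orbT le_min L0 mulr_ge0// ltW.
have tE i : (i <= N)%N -> t i = i%:R * (2 * r).
  move=> iN; apply/min_idPl; apply: le_trans NL.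
  by rewrite ler_wpM2r ?ler_nat// ltW.
pose z i := phi (t i).
have z0 : z 0%N = o.
  by rewrite /z tE// mul0r; case: seg.
have zN : z N.+1 = x.
  by rewrite /z /t (min_idPr _) ?(ltW LN)// EL; case: seg.
have step i : (i < N.+1)%N -> mdist (z i) (z i.+1) <= 2 * r.
  rewrite ltnS => iN; rewrite (segment_dist seg)// tE//.
  have ti1 : t i.+1 <= i%:R * (2 * r) + 2 * r.
    have <- : i.+1%:R * (2 * r) = i%:R * (2 * r) + 2 * r.
      by rewrite -natr1 mulrDl mul1r.
    by rewrite /t ge_min lexx.
  have ti : i%:R * (2 * r) <= t i.+1.
    rewrite /t le_min ler_wpM2r ?ler_nat ?(ltW r2)//=; apply: le_trans NL.
    by rewrite ler_wpM2r ?ler_nat// ltW.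
  by rewrite ler0_norm; lra.
have sep i j : (i < j < N.+1)%N -> 2 * r <= mdist (z i) (z j).
  rewrite ltnS => /andP[ij jN]; rewrite (segment_dist seg)//.
  rewrite !tE ?(leq_trans (ltnW ij))// distrC -mulrBl.
  rewrite normrM (gtr0_norm r2) ler_peMl ?(ltW r2)//.
  by rewrite -natrB ?(ltnW ij)// normr_nat ler1n subn_gt0.
have chain := chain_energy rP gP step sep.
pose tau := r `^ (1 + excess).
have tau0 : 0 < tau by apply: powR_gt0.
have tele : `|g o - g x| <= \sum_(i < N.+1) `|g (z i) - g (z i.+1)|.
  rewrite -[in g o]z0 -[in g x]zN; elim: (N.+1) => [|n IH].
    by rewrite big_ord0 subrr normr0.
  rewrite big_ord_recr/=; apply: le_trans (ler_distD (g (z n)) _ _) _.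
  by rewrite lerD2r.
apply: le_trans tele _.
apply: le_trans (ler_sum _ (fun (i : 'I_N.+1) _ =>
  le_linear_powR p_ge1 (normr_ge0 (g (z i) - g (z i.+1))) tau0)) _.
rewrite big_split/= sumr_const card_ord -mulr_sumr -[tau *+ _]mulr_natr mulrDl.
have p0 : 0 < p by apply: lt_le_trans p_ge1.
apply: lerD.
  rewrite /tau powRD ?(gt_eqF r_gt0) ?implybT// powRr1 ?(ltW r_gt0)//.
  rewrite mulrAC ler_wpM2r ?powR_ge0//.
  by rewrite -natr1 -EL; nra.
apply: le_trans (ler_wpM2l (powR_ge0 _ _) chain) _.
rewrite le_eqVlt; apply/orP; left; apply/eqP.
rewrite mulrCA; congr (_ * _).
rewrite /tau -powRrM -powRD ?(gt_eqF r_gt0) ?implybT//; congr powR.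
by rewrite /excess; field; rewrite lt0r_neq0.
Qed.

Hypothesis excess_gt0 : 0 < excess.
Hypothesis a_gt0 : 0 < a.
Hypothesis rad_gt0 : 0 < rad.
Hypothesis trees : forall x, is_tree (ball x rad).

Let M_ge0 : 0 <= M.
Proof.
have half1 : 0 < (2^-1 : R) < 1 by apply/andP; split; lra.
rewrite -lee_fin; apply: le_trans (energy half1).
by apply: integral_ge0 => x _; exact: besov_density_ge0.
Qed.

Let Q := rad + 1 + 2 * M / (K * c).
Let Q_ge0 : 0 <= Q.
Proof.
apply: addr_ge0; first by apply: addr_ge0 => //; exact: ltW.
by apply: divr_ge0; [exact: mulr_ge0|apply: ltW; exact: mulr_gt0].
Qed.

(** Where f is far from [g o] it is far from its own median [g x], hence from f
    on half of the ball around x, which costs energy. *)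
Lemma measure_deviation_le r o (g : X -> R) (k : R) : admissible r ->
  (forall x, is_median r x (g x)) -> 0 < k ->
  (m (ball o rad `&` [set x | k + Q * r `^ excess < `|f x - g o|]%R) <=
    (M / K * r `^ (p * a) / k `^ p)%:E)%E.
Proof.
move=> rP gP k0; case: (rP) => r_gt0 rr0 r1.
set H : set (borel X) := _ `&` _.
have mH : measurable H by exact: (measurable_deviation (measurable_metric_ball o rad) mf).
have := @energy_steps r 1 (fun=> H) (fun=> k) rP (fun _ _ => mH).
rewrite big_ord1 => le_M.
have Kk : 0 < K * k `^ p / r `^ (p * a).
  apply: divr_gt0; last by rewrite powR_gt0.
  by apply: mulr_gt0; rewrite ?powR_gt0.
suff : (m H * (K * k `^ p / r `^ (p * a))%:E <= M%:E)%E.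
  rewrite -lee_pdivlMr// -EFinM; congr (_ <= _%:E)%E.
  have G : r `^ (p * a) != 0 by rewrite gt_eqF// powR_gt0.
  have G' : k `^ p != 0 by rewrite gt_eqF// powR_gt0.
  by field; rewrite G G' lt0r_neq0.
rewrite muleC; apply: le_M => [|i x _|i _]; last exact: ltW.
  by apply/trivIsetP => i j /=; rewrite !ltnS !leqn0 => /eqP -> /eqP ->; rewrite eqxx.
move=> [ox /= fx]; have := ox; rewrite mdist_ball => oxi.
have oo : ball o rad o by exact: ballxx.
have [phi [seg _]] := (trees o).1 o x oo ox.
have := medians_close rP gP seg.
have Qx : (mdist o x + 1 + 2 * M / (K * c)) * r `^ excess <= Q * r `^ excess.
  by rewrite ler_wpM2r ?powR_ge0// !lerD2r ltW.
move=> /le_trans /(_ Qx) gap.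
have fg : k < `|f x - g x|.
  by have := ler_distD (g x) (f x) (g o); rewrite (distrC (g x)); lra.
have r4 : ball (x : X) r `<=` ball (x : X) (4 * r).
  by apply: le_ball; lra.
have [fxgx|gxfx] := leP (f x) (g x).
  exists (ball (x : X) r `&` [set y | g x <= f y]); split.
  - exact: (measurable_half x r (g x) false).
  - by move=> y [/r4].
  - exact: (gP x).2.
  - move=> y [_ /= gy]; apply: le_trans (ltW fg) _.
    by rewrite ler0_norm ?ger0_norm; lra.
exists (ball (x : X) r `&` [set y | f y <= g x]); split.
- exact: (measurable_half x r (g x) true).
- by move=> y [/r4].
- exact: (gP x).1.
- move=> y [_ /= gy]; apply: le_trans (ltW fg) _.
  by rewrite ger0_norm ?ler0_norm; lra.
Qed.

Hypothesis m_full : full_support m.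
Hypothesis m_finite : finite_balls m.

Lemma ae_constant_on_ball o : exists t : R,
  m (ball o rad `&` [set x | f x <> t]) = 0%E.
Proof.
have mB := measurable_metric_ball o rad.
have fin : m (ball o rad) \is a fin_num by rewrite ge0_fin_numE// m_finite.
have b0 : 0 < fine (m (ball o rad)).
  rewrite -lte_fin fineK//; apply: m_full; first exact: ball_is_open.
  by exists o; exact: ballxx.
apply: (ae_constant_of_concentration mB (esym (fineK fin)) b0 mf) => delta d0.
have d20 : 0 < delta / 2 by rewrite divr_gt0.
have a20 : 0 < a / 2 by rewrite divr_gt0.
have p0 : 0 < p by apply: lt_le_trans p_ge1.
have pa0 : 0 < p * a / 2 by rewrite divr_gt0// mulr_gt0.
have [rho1 rho1_gt0 small1] := small_powR ler01 a20 d20.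
have [rho2 rho2_gt0 small2] := small_powR Q_ge0 excess_gt0 d20.
have MK0 : 0 <= M / K by rewrite divr_ge0// ltW.
have [rho3 rho3_gt0 small3] := small_powR MK0 pa0 d0.
pose rho := Num.min (Num.min rho1 rho2) (Num.min rho3 (Num.min (r0 / 4) (1 / 4))).
have rho0 : 0 < rho by rewrite !lt_min rho1_gt0 rho2_gt0 rho3_gt0 !divr_gt0.
have r_gt0 : 0 < rho / 2 by rewrite divr_gt0.
have r_lt : rho / 2 < rho by rewrite ltr_pdivrMr// ltr_pMr// ltr1n.
move: r_lt; rewrite {2}/rho; move: (rho / 2) r_gt0 => r r_gt0.
rewrite !lt_min => /andP[/andP[rr1 rr2] /and3P[rr3 rr0 r1]].
have rP : admissible r by split=> //; lra.
have r00 : 0 < r < r0 by apply/andP; split=> //; lra.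
have [g gP] := median_function r00.
exists (g o); have k0 : 0 < r `^ (a / 2) by exact: powR_gt0.
(* With k = r^(a / 2), both k and the bound r^(p a) / k^p = r^(p a / 2) tend
   to 0. *)
apply: le_trans (le_trans (measure_deviation_le o rP gP k0) _).
  rewrite le_measure ?inE//; try exact: (measurable_deviation mB mf).
  apply: setIS => x /=; apply: le_lt_trans.
  by have := small1 _ r_gt0 rr1; have := small2 _ r_gt0 rr2; lra.
rewrite lee_fin; apply: le_trans (small3 _ r_gt0 rr3).
rewrite -mulrA ler_wpM2l// -powRrM -powRB ?(gt_eqF r_gt0) ?implybT//.
by rewrite le_eqVlt; apply/orP; left; apply/eqP; congr powR; field.
Qed.

Hypothesis X_connected : connected [set: X].
Hypothesis X_separable : separable X.

(** By full support, the constants of two overlapping balls agree; by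
    connectedness they are all equal, and the balls around a countable dense
    set cover the space. *)
Lemma ae_constant_of_energy : ae_constant m f.
Proof.
have [t tP] := choice ae_constant_on_ball.
have mN x : measurable (ball x rad `&` [set y | f y <> t x] : set (borel X)).
  apply: measurableI; first exact: measurable_metric_ball.
  rewrite (_ : [set y | _] = f @^-1` (~` [set t x])) //.
  by apply: (measurable_level mf); apply: measurableC; exact: measurable_set1.
have t_eq x y : (ball x rad `&` ball y rad) !=set0 -> t x = t y.
  move=> xy; apply: contrapT => txy.
  have : (0 < m (ball x rad `&` ball y rad))%E.
    by apply: m_full => //; apply: openI; exact: ball_is_open.
  apply/negP; rewrite -leNgt.
  apply: (@le_trans _ _ (m ((ball x rad `&` [set z | f z <> t x]) `|`
    (ball y rad `&` [set z | f z <> t y])))).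
    rewrite le_measure ?inE//.
    - by apply: measurableI; exact: measurable_metric_ball.
    - by apply: measurableU; exact: mN.
    - move=> z [xz yz]; have [fz|fz] := pselect (f z = t x); last by left.
      by right; split=> //=; rewrite fz.
  apply: le_trans (measureU2 _ _ _) _; [exact: mN|exact: mN|].
  by rewrite -[leRHS]adde0; apply: leeD; rewrite le_eqVlt; apply/predU1l; exact: tP.
have [D D_countable D_dense] := X_separable.
have t_near x y : ball x rad y -> t x = t y.
  by move=> xy; apply: t_eq; exists y; split=> //; exact: ballxx.
pose o : X := point.
have tT : [set x | t x = t o] = [set: X].
  have nbhs_t (x : X) : nbhs x (ball x rad) by exact: nbhsx_ballx.
  apply: X_connected; first by exists o.
    exists [set x | t x = t o]; last by rewrite setTI.
    rewrite openE => x /= tx; apply: filterS (nbhs_t x) => y /= /t_near <-.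
    exact: tx.
  exists [set x | t x = t o]; last by rewrite setTI.
  rewrite -openC openE => x /= tx; apply: filterS (nbhs_t x) => y /= /t_near <-.
  exact: tx.
exists (t o).
have [h h_inj] := countable_injP _ D_countable.
(* At most one point d of D has h d = n. *)
pose F n : set (borel X) := [set x | f x <> t o /\
  exists d : X, [/\ D d, h d = n & ball d rad x]].
have F0 n : m.-negligible (F n).
  have [[d [Dd hd]]|nd] := pselect (exists d, D d /\ h d = n); last first.
    suff -> : F n = set0 by exact: negligible_set0.
    by rewrite -subset0 => x [_ [d [Dd hd _]]]; apply: nd; exists d.
  exists (ball d rad `&` [set y | f y <> t d]); split; [exact: mN|exact: tP|].
  move=> x [fx [d' [Dd' hd' d'x]]].
  have <- : d' = d by apply: h_inj; rewrite ?inE// hd.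
  split=> //=; have : [set x | t x = t o] d' by rewrite tT.
  by move=> /= ->.
have := negligible_bigcup F0; apply: negligibleS => x /= fx.
have [d [xd Dd]] := D_dense (ball (x : X) rad)
  (ex_intro _ (x : X) (ballxx (x : X) rad_gt0)) (ball_is_open (x : X) rad).
by exists (h d) => //; split=> //; exists d; split=> //; exact: ball_sym.
Qed.

End Rigidity.

Lemma measure_bigsetU_le d (T : measurableType d) (R : realType)
    (m : {measure set T -> \bar R}) (I : eqType) (s : seq I) (B : I -> set T)
    (v : R) : (forall i, measurable (B i)) ->
  (forall i, i \in s -> (m (B i) <= v%:E)%E) ->
  (m (\big[setU/set0]_(i <- s) B i) <= ((size s)%:R * v)%:E)%E.
Proof.
move=> mB; elim: s => [_|i s IH Bv].
  by rewrite big_nil measure0 mul0r.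
rewrite big_cons; apply: le_trans (measureU2 _ _ _) _ => //.
  exact: bigsetU_measurable.
rewrite /= -natr1 mulrDl mul1r [X in X%:E]addrC EFinD; apply: leeD.
  by apply: Bv; rewrite mem_head.
by apply: IH => j js; apply: Bv; rewrite inE js orbT.
Qed.

(** * A non-constant function at the critical exponent *)

Section EnergyUpperBound.
Context {R : realType} {X : pmetricType R}.
Variable m : {measure set (borel X) -> \bar R}.
Implicit Types (x y : X) (r p a : R) (f : borel X -> R).

Hypothesis m_full : full_support m.
Hypothesis m_finite : finite_balls m.

Lemma besov_density_le p a f r x (k : R) : 0 <= p -> 0 < r -> 0 <= k ->
  (forall y, ball x r y -> `|f y - f x| <= k) ->
  (besov_density m p a f r x <= (k `^ p / r `^ (p * a))%:E)%E.
Proof.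
move=> p0 r0 k0 fk.
have mb : (0 < m (ball x r))%E.
  exact: (m_full (ball_is_open x r) (ex_intro _ x (ballxx x r0))).
have mfin : m (ball x r) \is a fin_num by rewrite ge0_fin_numE// m_finite.
have q0 : 0 <= k `^ p / r `^ (p * a) by rewrite divr_ge0 ?powR_ge0.
apply: (@le_trans _ _ ((m (ball x r))^-1 *
    \int[m]_(y in ball x r) (k `^ p / r `^ (p * a))%:E)%E).
  apply: lee_wpmul2l; first by rewrite inve_ge0.
  apply: ge0_le_integral_any => y /fk fy.
  rewrite !lee_fin divr_ge0 ?powR_ge0//= ler_wpM2r ?invr_ge0 ?powR_ge0//.
  by rewrite ge0_ler_powR ?nnegrE.
have mbr := measurable_metric_ball x r.
rewrite integral_cst//.
rewrite muleCA; move: mb mfin; case: (m (ball x r)) => // v; rewrite lte_fin => v0 _.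
by rewrite inver gt_eqF// -!EFinM mulVf ?gt_eqF// mulr1.
Qed.

Lemma besov_energy_le p a f r (S : set (borel X)) (k : R) :
  0 < p -> 0 < r -> 0 <= k -> measurable S ->
  (forall x y, S x -> ball (x : X) r y -> `|f y - f x| <= k) ->
  (forall x y, ~ S x -> ball (x : X) r y -> f y = f x) ->
  (besov_energy m p a f r <= (k `^ p / r `^ (p * a))%:E * m S)%E.
Proof.
move=> p0 r0 k0 mS Sk Sf.
have q0 : 0 <= k `^ p / r `^ (p * a) by rewrite divr_ge0 ?powR_ge0.
apply: (@le_trans _ _ (\int[m]_x ((k `^ p / r `^ (p * a))%:E * (\1_S x)%:E))%E).
  apply: ge0_le_integral_any => x _; apply/andP; split.
    exact: besov_density_ge0.
  rewrite indicE; case: (boolP (x \in S)) => [|].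
    rewrite inE mule1 => Sx; apply: besov_density_le => //; first exact: ltW.
    by move=> y; exact: Sk.
  move=> /negP; rewrite inE => Sx.
  rewrite mule0; have := @besov_density_le p a f r x 0 (ltW p0) r0 (lexx _).
  rewrite powR0 ?gt_eqF// mul0r; apply => y xy.
  by rewrite (Sf _ _ Sx xy) subrr normr0.
rewrite ge0_integralZl//.
- by rewrite integral_indic// setIT.
- by apply/measurable_EFinP; exact: measurable_indic.
Qed.

End EnergyUpperBound.

Section Lattice.
Context {R : realType}.
Implicit Types u v k : R.

Lemma dist_max_le u v u' v' k : `|u - u'| <= k -> `|v - v'| <= k ->
  `|Num.max u v - Num.max u' v'| <= k.
Proof.
rewrite !ler_norml => /andP[? ?] /andP[? ?].
by case: (leP u v) => ?; case: (leP u' v') => ?; apply/andP; split; lra.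
Qed.

Lemma dist_min_le u v u' v' k : `|u - u'| <= k -> `|v - v'| <= k ->
  `|Num.min u v - Num.min u' v'| <= k.
Proof.
rewrite !ler_norml => /andP[? ?] /andP[? ?].
by case: (leP u v) => ?; case: (leP u' v') => ?; apply/andP; split; lra.
Qed.

End Lattice.

Section LipschitzMeasurable.
Context {R : realType} {X : pmetricType R}.

Lemma measurable_lipschitz (f : borel X -> R) :
  (forall x y : X, `|f x - f y| <= mdist x y) -> measurable_fun setT f.
Proof.
move=> lip; apply: (measurability _ (RGenOInfty.measurableE R)).
move=> _ [_ [t ->] <-]; rewrite setTI; apply: sub_sigma_algebra.
rewrite openE => x /=; rewrite in_itv/= andbT => tx.
rewrite /interior; apply: (filterS _ (nbhsx_ballx (x : X) (f x - t) _)).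
  move=> y; rewrite mdist_ball /= in_itv/= andbT => xy.
  by have := lip x y; rewrite ler_norml => /andP[_]; lra.
by rewrite subr_gt0.
Qed.

End LipschitzMeasurable.

Section TestFunction.
Context {R : realType} {X : pmetricType R}.
Variable m : {measure set (borel X) -> \bar R}.
Variables (r0 c C dh rad rho : R) (o : X).
Hypotheses (c_gt0 : 0 < c).
Hypothesis volume : forall (x : X) (r : R), 0 < r < r0 ->
  ((c * r `^ dh)%:E <= m (ball x r) <= (C * r `^ dh)%:E)%E.
Hypothesis m_full : full_support m.
Hypothesis m_finite : finite_balls m.
Hypothesis tree : is_tree (ball o rad).
Hypotheses (rho_gt0 : 0 < rho) (rho_rad : 4 * rho < rad) (rho_r0 : rho < r0).
Implicit Types (x y a b : X) (r : R).

Local Ltac lra_rho :=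
  have ? := rho_gt0; have ? := rho_rad; lra.

Lemma exists_sphere_point : connected [set: X] -> (rad%:E <= diam X)%E ->
  exists y, mdist o y = 2 * rho :> R.
Proof.
move=> Xc rad_diam; apply: contrapT => nS.
have oo : ball o (2 * rho) o by apply: ballxx; rewrite mulr_gt0.
have BT : ball o (2 * rho) = [set: X].
  apply: Xc; first by exists o.
    by exists (ball o (2 * rho)); [exact: ball_is_open|rewrite setTI].
  exists (ball o (2 * rho)); last by rewrite setTI.
  rewrite -openC openE => y; rewrite /= mdist_ball => /negP; rewrite -leNgt => oy.
  have {}oy : 2 * rho < mdist o y.
    rewrite lt_neqAle oy andbT; apply/eqP => E; apply: nS.
    by exists y.
  rewrite /interior; apply: (filterS _ (nbhsx_ballx y (mdist o y - 2 * rho) _)).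
    move=> z; rewrite /= !mdist_ball => yz oz.
    by have := mdist_triangle o z y; rewrite (mdist_sym z y); lra_rho.
  by rewrite subr_gt0.
suff : (diam X <= (4 * rho)%:E)%E.
  by move=> /(le_trans rad_diam); rewrite lee_fin leNgt rho_rad.
apply: ge_ereal_sup => _ [x _ [y _ <-]]; rewrite lee_fin.
have : ball o (2 * rho) x by rewrite BT.
have : ball o (2 * rho) y by rewrite BT.
rewrite !mdist_ball => oy ox.
by have := mdist_triangle x o y; rewrite (mdist_sym x o); lra_rho.
Qed.

Definition separated_on_sphere (s : seq X) : Prop :=
  (forall a, a \in s -> mdist o a = 2 * rho :> R) /\
  pairwise (fun a b => 2 * rho < mdist a b) s.

Lemma size_separated s : separated_on_sphere s ->
  (((size s)%:R * (c * rho `^ dh))%:E <= m (ball o (4 * rho)))%E.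
Proof.
move=> [sS sep].
have mU (u : seq X) : measurable (\big[setU/set0]_(a <- u) ball a rho : set (borel X)).
  by apply: bigsetU_measurable => a _; exact: measurable_metric_ball.
apply: (@le_trans _ _ (m (\big[setU/set0]_(a <- s) ball a rho))); last first.
  rewrite le_measure ?inE//; first exact: measurable_metric_ball.
  rewrite -bigcup_seq => x [a /= /sS oa]; rewrite !mdist_ball => ax.
  by have := mdist_triangle o a x; have ? := rho_gt0; lra.
elim: s sep {sS} => [_|a s IH]; first by rewrite mul0r big_nil measure0.
rewrite /= => /andP[/allP as_sep sep].
rewrite big_cons measureU//; first last.
- rewrite -bigcup_seq -subset0 => x [ax [b /= /as_sep ab]].
  move: ax; rewrite !mdist_ball => ax bx.
  by have := mdist_triangle a x b; rewrite (mdist_sym x b); have ? := rho_gt0; lra.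
- exact: measurable_metric_ball.
rewrite -natr1 mulrDl mul1r [X in X%:E]addrC EFinD; apply: leeD; last exact: IH.
by have /andP[] := volume a (introT andP (conj rho_gt0 rho_r0)).
Qed.

(** A 2 rho-separated family on the sphere of radius 2 rho that has the maximal
    number of points; this number is bounded, since the balls of radius rho
    around these points are disjoint and lie in a ball of finite measure. *)
Lemma exists_sphere_net : exists s : seq X,
  (forall a, a \in s -> mdist o a = 2 * rho :> R) /\
  (forall y, mdist o y = 2 * rho :> R -> exists2 a, a \in s & mdist y a <= 2 * rho).
Proof.
pose P n := `[< exists2 s, separated_on_sphere s & size s = n >].
have P0 : exists n, P n by exists 0%N; apply/asboolP; exists [::].
have cr : 0 < c * rho `^ dh by rewrite mulr_gt0// powR_gt0.
have fin : m (ball o (4 * rho)) \is a fin_num.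
  by rewrite ge0_fin_numE// m_finite// mulr_gt0.
have Pbound n : P n ->
    (n <= Num.truncn (fine (m (ball o (4 * rho))) / (c * rho `^ dh)))%N.
  move=> /asboolP[s /size_separated + <-]; rewrite -(fineK fin) lee_fin => le.
  by rewrite truncn_ge_nat ?divr_ge0 ?(ltW cr) ?fine_ge0// ler_pdivlMr.
case: (ex_maxnP P0 Pbound) => n /asboolP[s [sS sep] size_s] maxn.
exists s; split=> // y oy; apply: contrapT => far.
have : P (size s).+1.
  apply/asboolP; exists (y :: s) => //; split=> [a|].
    by rewrite inE => /predU1P[->//|]; exact: sS.
  rewrite /= sep andbT; apply/allP => a sa; rewrite ltNge; apply/negP => ya.
  by apply: far; exists a.
by move=> /maxn; rewrite size_s ltnn.
Qed.

Variable s : seq X.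
Hypothesis s_sphere : forall a, a \in s -> mdist o a = 2 * rho :> R.
Hypothesis s_net : forall y, mdist o y = 2 * rho :> R ->
  exists2 a, a \in s & mdist y a <= 2 * rho.

(** In a tree, the distance from o to the projection of x onto the finite tree
    formed by the initial parts, of length rho, of the geodesics from o to the
    points of s. *)
Definition skeleton_height x : R :=
  \big[Num.max/0]_(a <- s) Num.min rho (gromov_product o x a).

Lemma skeleton_height_ge x a : a \in s ->
  Num.min rho (gromov_product o x a) <= skeleton_height x.
Proof.
move=> sa; exact: (@Order.TotalTheory.le_bigmax_seq _ _ _ s (0 : R) a xpredT
  (fun a => Num.min rho (gromov_product o x a)) sa isT).
Qed.

Lemma skeleton_height_ge0 x : 0 <= skeleton_height x.
Proof. exact: bigmax_ge_id. Qed.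

Lemma skeleton_height_le x : skeleton_height x <= rho.
Proof.
by apply: bigmax_le => [|a _]; [exact: ltW|rewrite ge_min lexx].
Qed.

Lemma skeleton_height_witness x : 0 < skeleton_height x ->
  exists2 a, a \in s & skeleton_height x = Num.min rho (gromov_product o x a).
Proof.
rewrite /skeleton_height; elim: s => [|a u IH]; first by rewrite big_nil ltxx.
rewrite big_cons; set h := Num.min rho _; set g := \big[_/_]_(_ <- _) _.
case: (leP h g) => [_ /IH[b bu gE]|_ _].
  by exists b => //; rewrite inE bu orbT.
by exists a => //; rewrite mem_head.
Qed.

Lemma skeleton_height_lip x y :
  `|skeleton_height x - skeleton_height y| <= mdist x y.
Proof.
rewrite /skeleton_height; elim: s => [|a u IH].
  by rewrite !big_nil subrr normr0 mdist_ge0.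
rewrite !big_cons; apply: dist_max_le => //; apply: dist_min_le.
  by rewrite subrr normr0 mdist_ge0.
exact: gromov_lip.
Qed.

Lemma skeleton_height_center : skeleton_height o = 0.
Proof.
apply/le_anti; rewrite skeleton_height_ge0 andbT; apply: bigmax_le => // a _.
by rewrite /gromov_product mdistxx ge_min; apply/orP; right; lra_rho.
Qed.

Let in_ball x : mdist o x < rad -> ball o rad x.
Proof. by rewrite mdist_ball. Qed.

(** The point at radius 2 rho on the way to x is within 2 rho of a point a of
    the net, so it branches off from a at radius rho or later, and x with it. *)
Lemma skeleton_height_far x : 2 * rho <= mdist o x -> mdist o x < rad ->
  skeleton_height x = rho.
Proof.
move=> ox xi; apply/le_anti; rewrite skeleton_height_le/=.
have oo : ball o rad o by apply: ballxx; lra_rho.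
have [phi [seg _]] := tree.1 _ _ oo (in_ball xi).
have yI : 0 <= 2 * rho <= mdist o x by rewrite ox mulr_ge0// ltW.
have oy := segment_dist0 seg yI; have yx := segment_dist1 seg yI.
set y := phi (2 * rho) in oy yx.
have [a sa ya] := s_net oy.
apply: le_trans (skeleton_height_ge x sa).
rewrite le_min lexx/=; have oa := s_sphere sa.
have := tree_hyperbolic (a := y) tree oo (in_ball xi) (in_ball (x := a) _).
have /[swap]/[apply] : ball o rad y by apply: in_ball; lra_rho.
have -> : gromov_product o x y = 2 * rho by rewrite /gromov_product (mdist_sym x y); lra_rho.
have : rho <= gromov_product o a y by rewrite /gromov_product (mdist_sym a y); lra_rho.
have -> : mdist o a < rad by lra_rho.
by rewrite ge_min => ? /(_ erefl)/orP[] ?; lra_rho.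
Qed.

(** Cutting at radius 2 rho creates no jump: [rho - skeleton_height x] vanishes
    from there to the boundary of the tree ball. *)
Definition test_function (x : borel X) : R :=
  if mdist o (x : X) < 2 * rho then rho - skeleton_height x else 0.

Lemma test_function_in x : mdist o x < rad ->
  test_function x = rho - skeleton_height x.
Proof.
move=> xi; rewrite /test_function; case: (ltP (mdist o x) _) => // ox.
by rewrite (skeleton_height_far ox xi) subrr.
Qed.

Lemma test_function_out x : 2 * rho <= mdist o x -> test_function x = 0.
Proof. by rewrite /test_function ltNge => ->. Qed.

Lemma test_function_ge0 x : 0 <= test_function x.
Proof.
by rewrite /test_function; case: ifP => // _; rewrite subr_ge0 skeleton_height_le.
Qed.

Lemma test_function_le x : test_function x <= rho.
Proof.
rewrite /test_function; case: ifP => [_|_]; last exact: ltW.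
by rewrite gerBl skeleton_height_ge0.
Qed.

Lemma test_function_cases x y : mdist x y < rho ->
  (mdist o x < rad /\ mdist o y < rad) \/
  (test_function x = 0 /\ test_function y = 0).
Proof.
move=> xy; have [ox|ox] := ltP (mdist o x) (3 * rho).
  by left; have := mdist_triangle o x y; split; lra_rho.
right; rewrite !test_function_out//; try lra_rho.
by have := mdist_triangle o y x; rewrite (mdist_sym y x); lra_rho.
Qed.

Lemma test_function_lip x y : mdist x y < rho ->
  `|test_function y - test_function x| <= mdist x y.
Proof.
move=> /test_function_cases[[ox oy]|[-> ->]]; last first.
  by rewrite subrr normr0 mdist_ge0.
rewrite !test_function_in// [X in `|X|](_ : _ =
  skeleton_height x - skeleton_height y); last by ring.
exact: skeleton_height_lip.
Qed.

Lemma measurable_test_function : measurable_fun setT test_function.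
Proof.
have -> : test_function =
    (fun x => (rho - skeleton_height x) * \1_(ball o (2 * rho)) x).
  apply/funext => x; rewrite indicE /test_function; case: ifPn => ox.
    by rewrite mem_set ?mulr1// mdist_ball.
  by rewrite memNset ?mulr0// mdist_ball; exact/negP.
apply: measurable_funM; last by apply: measurable_indic; exact: measurable_metric_ball.
apply: measurable_funB => //; apply: measurable_lipschitz.
exact: skeleton_height_lip.
Qed.

(** If x and y project to different points of the skeleton, then the geodesic
    between them runs along the skeleton; x leaves the branch of a first, at
    radius t, and by hyperbolicity this point lies between x and y. *)
Lemma skeleton_near x y r phi : mdist o x < rad -> mdist o y < rad ->
  mdist x y < r -> skeleton_height x < skeleton_height y ->
  (forall a, a \in s -> is_segment (ball o rad) o a (phi a)) ->
  exists2 a, a \in s & exists2 t, 0 <= t < rho &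
    mdist (phi a t) x < r /\ mdist (phi a t) y < r.
Proof.
move=> ox oy xy hxy segs.
have [a sa ya] := skeleton_height_witness (le_lt_trans (skeleton_height_ge0 x) hxy).
exists a => //; have xa := skeleton_height_ge x sa.
have {xa ya hxy} : Num.min rho (gromov_product o x a) < Num.min rho (gromov_product o y a).
  by rewrite -ya (le_lt_trans xa).
set t := gromov_product o x a => xy_a.
have [t_rho t_ya] : t < rho /\ t < gromov_product o y a.
  move: xy_a; case: (leP rho t) => [? |?].
    by rewrite lt_min ltxx.
  by rewrite lt_min => /andP[].
have oo : ball o rad o by apply: ballxx; lra_rho.
have oa := s_sphere sa.
have ai : ball o rad a by apply: in_ball; lra_rho.
have t0 : 0 <= t by exact: gromov_ge0.
have tI : 0 <= t <= mdist o a by rewrite t0; lra_rho.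
exists t; first by rewrite t0.
have seg := segs _ sa; have ot := segment_dist0 seg tI.
have ta := segment_dist1 seg tI.
set z := phi a t in ot ta *.
have zi : ball o rad z by apply: in_ball; rewrite ot; lra_rho.
have za : gromov_product o z a = t by rewrite /gromov_product ot ta; lra_rho.
have xyt : gromov_product o x y <= t.
  have := tree_hyperbolic (a := y) tree oo (in_ball ox) ai (in_ball oy).
  rewrite -/t (gromovC o a y) ge_min => /orP[]//.
  by rewrite leNgt t_ya.
have zx := tree_hyperbolic tree oo zi (in_ball ox) ai.
have zy := tree_hyperbolic tree oo zi (in_ball oy) ai.
move: zx zy; rewrite za -/t minxx (min_idPl (ltW t_ya)).
move: xyt; have := gromov_le o x a; rewrite -/t.
have := mdist_triangle o y a; have := t_ya.
by rewrite /gromov_product ot => *; split; lra_rho.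
Qed.

(** The initial parts of length rho of the geodesics to s are covered by about
    rho / r balls of radius 2 r each. *)
Lemma variation_set_small r : 0 < r -> r < rho -> 2 * r < r0 ->
  exists S : set (borel X), [/\ measurable S,
    (m S <= ((size s)%:R * (2 * rho / r) * (C * (2 * r) `^ dh))%:E)%E &
    forall x y, ~ S x -> ball (x : X) r y -> test_function y = test_function x].
Proof.
move=> r_gt0 r_rho r_r0.
have oo : ball o rad o by apply: ballxx; lra_rho.
have [phi segs] : exists phi : X -> R -> X,
    forall a, a \in s -> is_segment (ball o rad) o a (phi a).
  suff /choice[phi phiP] : forall a, exists phi : R -> X,
      a \in s -> is_segment (ball o rad) o a phi by exists phi.
  move=> a; have [sa|_] := boolP (a \in s); last by exists (fun=> o).
  have ai : ball o rad a by apply: in_ball; rewrite s_sphere//; lra_rho.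
  by have [phi [seg _]] := tree.1 _ _ oo ai; exists phi.
pose K := Num.truncn (rho / r).
have /andP[K_le K_gt] : K%:R <= rho / r < K.+1%:R.
  by apply: truncn_itv; rewrite divr_ge0// ltW.
pose idx := [seq (b, k) | b <- s, k <- iota 0 K.+1].
pose node (bk : X * nat) : set (borel X) := ball (phi bk.1 (bk.2%:R * r)) (2 * r).
have mnode bk : measurable (node bk) by exact: measurable_metric_ball.
exists (\big[setU/set0]_(bk <- idx) node bk); split.
- exact: bigsetU_measurable.
- have r2 : 0 < 2 * r < r0 by rewrite r_r0 mulr_gt0.
  have v0 : 0 <= C * (2 * r) `^ dh.
    have /andP[_] := volume o r2; rewrite -lee_fin; apply: le_trans.
    exact: measure_ge0.
  apply: (@le_trans _ _ ((size idx)%:R * (C * (2 * r) `^ dh))%:E).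
    apply: measure_bigsetU_le => // bk _.
    by have /andP[] := volume (phi bk.1 (bk.2%:R * r)) r2.
  rewrite lee_fin ler_wpM2r// size_allpairs size_iota natrM ler_wpM2l//.
  rewrite -natr1 -mulrA mulr_natl mulr2n lerD// ler_pdivlMr// mul1r.
  exact: ltW.
move=> x y nSx; rewrite mdist_ball => xy.
have [[ox oy]|[-> -> //]] := test_function_cases (lt_trans xy r_rho).
rewrite !test_function_in//; congr (_ - _); apply: contrapT => hxy.
have {hxy}[b sb [t /andP[t0 t_rho] bx]] : exists2 b, b \in s &
    exists2 t, 0 <= t < rho & mdist (phi b t) x < r.
  have [lt|lt|E] := ltgtP (skeleton_height x) (skeleton_height y);
    last by case: hxy; rewrite E.
    have [b sb [t tI [bx _]]] := skeleton_near ox oy xy lt segs.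
    by exists b => //; exists t.
  have yx : mdist y x < r by rewrite mdist_sym.
  have [b sb [t tI [_ bx]]] := skeleton_near oy ox yx lt segs.
  by exists b => //; exists t.
pose k := Num.truncn (t / r).
have /andP[k_le k_gt] : k%:R <= t / r < k.+1%:R.
  by apply: truncn_itv; rewrite divr_ge0// ltW.
have kK : (k <= K)%N.
  by apply: le_truncn; rewrite ler_pM2r ?invr_gt0// ltW.
rewrite ler_pdivlMr// in k_le; rewrite ltr_pdivrMr// -natr1 mulrDl mul1r in k_gt.
apply: nSx; rewrite -bigcup_seq; exists (b, k) => /=.
  by apply: allpairs_f => //; rewrite mem_iota/= add0n ltnS.
rewrite /node mdist_ball/=.
have kr0 : 0 <= k%:R * r by rewrite mulr_ge0// ltW.
have ob := s_sphere sb.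
have := mdist_triangle (phi b (k%:R * r)) (phi b t) x.
rewrite (segment_dist (segs _ sb)); last 2 first.
- by rewrite kr0 ob; lra_rho.
- by rewrite t0 ob; lra_rho.
by rewrite ler0_norm; lra.
Qed.

Lemma test_function_Lfun p : 0 < p -> test_function \in Lfun m p%:E.
Proof.
move=> p0; rewrite inE; apply/andP; split; rewrite inE/=.
  exact: measurable_test_function.
rewrite /finite_norm unlock; apply: poweR_lty.
have mb := measurable_metric_ball o (2 * rho).
apply: (@le_lt_trans _ _ (\int[m]_x
    ((rho `^ p)%:E * (\1_(ball o (2 * rho)) x)%:E))%E).
  apply: ge0_le_integral_any => x _; rewrite poweR_ge0/= indicE.
  have [ox|ox] := ltP (mdist o (x : X)) (2 * rho).
    rewrite mem_set ?mdist_ball// mule1 lee_fin ger0_norm ?test_function_ge0//.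
    rewrite ge0_ler_powR ?nnegrE ?test_function_ge0 ?test_function_le ?ltW//.
  rewrite memNset ?mdist_ball; last by apply/negP; rewrite -leNgt.
  by rewrite test_function_out// normr0 powR0 ?gt_eqF// mule0.
rewrite ge0_integralZl//; first last.
- by rewrite lee_fin powR_ge0.
- by apply/measurable_EFinP; exact: measurable_indic.
rewrite integral_indic// setIT lte_mul_pinfty ?lee_fin ?powR_ge0//.
by rewrite m_finite// mulr_gt0.
Qed.

Lemma test_function_nonconstant : s != [::] -> ~ ae_constant m test_function.
Proof.
move=> /eqP s0; have [b sb] : exists b, b \in s.
  by case: (s) s0 => // b u _; exists b; rewrite mem_head.
move=> [t [N [mN N0 sub]]].
have hit x : exists2 y, mdist x y < rho / 4 & test_function y = t.
  have q0 : 0 < rho / 4 by rewrite divr_gt0.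
  apply: contrapT => miss.
  have := m_full (ball_is_open x (rho / 4)) (ex_intro _ x (ballxx x q0)).
  apply/negP; rewrite -leNgt -N0; apply: le_measure; rewrite ?inE//.
    exact: measurable_metric_ball.
  move=> y; rewrite mdist_ball => xy; apply: sub => /= yt.
  by apply: miss; exists y.
have ob := s_sphere sb.
have [y oy yt] := hit o; have [z bz zt] := hit b.
have bz' := mdist_triangle o b z.
have hb : skeleton_height b = rho by apply: skeleton_height_far; lra_rho.
have oyr : mdist o y < rad by lra_rho.
have ozr : mdist o z < rad by lra_rho.
have hy := skeleton_height_lip o y; have hz := skeleton_height_lip b z.
rewrite test_function_in// in yt; rewrite test_function_in// in zt.
move: hy hz; rewrite hb skeleton_height_center !ler_norml.
move=> /andP[hy1 hy2] /andP[hz1 hz2].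
suff : rho < rho by rewrite ltxx.
lra_rho.
Qed.

(** At small radii, r^p times the measure of the variation set is of order
    r^(p + dh - 1).  At the remaining radii, the energy is at most a constant
    times the measure of one ball. *)
Lemma test_function_energy p : 1 <= dh -> 1 <= p ->
  (ereal_sup [set besov_energy m p (1 + (dh - 1) / p) test_function r
     | r in `]0%R, 1%R[] < +oo)%E.
Proof.
move=> dh1 p1; have p0 : 0 < p by apply: lt_le_trans p1.
have pa : p * (1 + (dh - 1) / p) = p + dh - 1 by field; rewrite gt_eqF.
pose rho1 := Num.min rho (r0 / 2).
have rho1_gt0 : 0 < rho1.
  by rewrite lt_min rho_gt0 divr_gt0// (lt_trans rho_gt0).
pose D : set (borel X) := ball o (2 * rho + 1).
have D_gt0 : 0 < 2 * rho + 1 by lra_rho.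
have finD : m D \is a fin_num by rewrite ge0_fin_numE// m_finite.
pose B1 := (size s)%:R * (2 * rho) * (C * 2 `^ dh).
pose B2 := rho `^ p / rho1 `^ (p + dh - 1) * fine (m D).
apply: (@le_lt_trans _ _ (Num.max B1 B2)%:E); last exact: ltry.
apply: ge_ereal_sup => _ [r /= + <-]; rewrite in_itv/= => /andP[r_gt0 r1].
have [r_small|r_large] := ltP r rho1.
  move: r_small; rewrite lt_min => /andP[r_rho r_r0].
  have {}r_r0 : 2 * r < r0 by rewrite mulrC -ltr_pdivlMr.
  have [S [mS S_le Sout]] := variation_set_small r_gt0 r_rho r_r0.
  apply: (@le_trans _ _ B1%:E); last by rewrite lee_fin le_max lexx.
  apply: le_trans (besov_energy_le m_full m_finite _ p0 r_gt0 (ltW r_gt0) mS _ Sout) _.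
    move=> x y _; rewrite mdist_ball => xy.
    exact: le_trans (test_function_lip (lt_trans xy r_rho)) (ltW xy).
  rewrite pa; have q0 : 0 <= r `^ p / r `^ (p + dh - 1).
    by rewrite divr_ge0 ?powR_ge0.
  apply: le_trans (lee_wpmul2l _ S_le) _; first by rewrite lee_fin.
  rewrite -EFinM lee_fin le_eqVlt; apply/orP; left; apply/eqP.
  rewrite powRM ?(ltW r_gt0)// powRB ?(gt_eqF r_gt0) ?implybT//.
  rewrite powRD ?(gt_eqF r_gt0) ?implybT// powRr1 ?(ltW r_gt0)// /B1.
  have G z : r `^ z != 0 by rewrite gt_eqF// powR_gt0.
  by field; rewrite !G gt_eqF.
apply: (@le_trans _ _ B2%:E); last by rewrite lee_fin le_max lexx orbT.
have mD : measurable D by exact: measurable_metric_ball.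
apply: le_trans (besov_energy_le m_full m_finite _ p0 r_gt0 (ltW rho_gt0) mD _ _) _.
- move=> x y _ _; have := test_function_ge0 x; have := test_function_ge0 y.
  have := test_function_le x; have := test_function_le y.
  by rewrite ler_norml => *; apply/andP; split; lra_rho.
- move=> x y; rewrite /D !mdist_ball => /negP; rewrite -leNgt => ox xy.
  have := mdist_triangle o y x; rewrite (mdist_sym y x) => oy.
  by rewrite !test_function_out//; lra_rho.
rewrite -(fineK finD) -EFinM lee_fin ler_wpM2r ?fine_ge0// ler_wpM2l ?powR_ge0//.
rewrite pa lef_pV2 ?posrE ?powR_gt0// ge0_ler_powR ?nnegrE ?(ltW rho1_gt0) ?(ltW r_gt0)//.
by lra.
Qed.

End TestFunction.

(** * The critical exponent *)

Unset Implicit Arguments.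

Theorem lemma3p10 (R : realType) (X : pmetricType R)
    (m : {measure set (borel X) -> \bar R}) (dh p : R)
    (X_locally_compact : locally_compact [set: X])
    (X_connected : connected [set: X])
    (X_separable : separable X)
    (X_tree : uniform_local_tree X)
    (m_radon : radon m)
    (m_full : full_support m)
    (m_finite : finite_balls m)
    (dh_ge1 : 1 <= dh)
    (m_volume : uniform_volume_control m (fun r => r `^ dh))
    (p_ge1 : 1 <= p) :
  ereal_sup [set a%:E | a in [set a : R | 0 <= a /\
      exists2 f, besov_lipschitz m a p f & ~ ae_constant m f]]
  = (1 + (dh - 1) / p)%:E.
Proof.
have [rad [rad_gt0 rad_diam trees]] := X_tree.
have [r0 [c [C [r0_gt0 c_gt0 C_gt0 volume]]]] := m_volume.
have p_gt0 : 0 < p by apply: lt_le_trans p_ge1.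
have slope_ge0 : 0 <= (dh - 1) / p by rewrite divr_ge0 ?subr_ge0// ltW.
apply/le_anti/andP; split.
  apply: ge_ereal_sup => _ [a [a_ge0 [f [f_Lp f_energy] f_var]] <-].
  rewrite lee_fin leNgt; apply/negP => a_gt; apply: f_var.
  have mf : measurable_fun setT f.
    by move: f_Lp; rewrite inE => /andP[]; rewrite inE.
  set E := ereal_sup _ in f_energy.
  have le_E r : 0 < r < 1 -> (besov_energy m p a f r <= E)%E.
    by move=> r01; apply: ereal_sup_ubound; exists r => //=; rewrite in_itv.
  have E_ge0 : (0 <= E)%E.
    have half1 : 0 < (2^-1 : R) < 1 by apply/andP; split; lra.
    apply: le_trans (le_E _ half1).
    by apply: integral_ge0 => x _; exact: besov_density_ge0.
  have E_fin : E \is a fin_num by rewrite ge0_fin_numE.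
  rewrite -(fineK E_fin) in le_E.
  apply: (ae_constant_of_energy r0_gt0 c_gt0 C_gt0 volume p_ge1 mf le_E
    _ _ rad_gt0 trees) => //.
  - by rewrite subr_gt0.
  - by apply: lt_trans a_gt; lra.
apply: ereal_sup_ubound; exists (1 + (dh - 1) / p) => //; split.
  by rewrite addr_ge0.
pose rho := Num.min rad r0 / 5.
have min_gt0 : 0 < Num.min rad r0 by rewrite lt_min rad_gt0.
have rho_gt0 : 0 < rho by rewrite divr_gt0.
have min_rad : Num.min rad r0 <= rad by rewrite ge_min lexx.
have min_r0 : Num.min rad r0 <= r0 by rewrite ge_min lexx orbT.
have rho_rad : 4 * rho < rad by rewrite /rho; lra.
have rho_r0 : rho < r0 by rewrite /rho; lra.
pose o : X := point.
have [s [s_sphere s_net]] :=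
  exists_sphere_net o c_gt0 volume m_finite rho_gt0 rho_r0.
have s_neq0 : s != [::].
  have [y oy] := exists_sphere_point o rho_gt0 rho_rad X_connected rad_diam.
  by have [b sb _] := s_net _ oy; apply/eqP => s0; rewrite s0 in sb.
exists (test_function rho o s).
  split.
    exact: test_function_Lfun.
  exact: (test_function_energy volume m_full m_finite (trees o)
    rho_gt0 rho_rad rho_r0 s_sphere s_net).
exact: (test_function_nonconstant m_full (trees o) rho_gt0 rho_rad
  s_sphere s_net).
Qed.
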